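(* Let $k$ be a field. Let $k(Q,\mathcal A)$ and $k(P,\mathcal B)$ be two normal generalized path algebras with finite quivers $Q$ and $P$ (acyclic or not). Then $k(Q,\mathcal A)$ and $k(P,\mathcal B)$ are isomorphic as $k$-algebras if and only if their corresponding normal $k$-pre-modulations are isomorphic.
   Context: Let $Q=(Q_0,Q_1)$ be a finite quiver and $\mathcal A=\{A_i\mid i\in Q_0\}$ a family of finite-dimensional unital $k$-algebras. Let $\Omega(i,j)$ be the set of arrows from $i$ to $j$, $A_0=\prod_{i\in Q_0}A_i$, ${}_iM_j=A_i\Omega(i,j)A_j$ the free $A_i$-$A_j$-bimodule (free $A_i\otimes_kA_j^{op}$-module) with basis $\Omega(i,j)$, and $M=\bigoplus_{(i,j)}{}_iM_j$. The generalized path algebra is the tensor algebra $k(Q,\mathcal A)=T(A_0,M)=\bigoplus_{n\ge0}M^{\otimes_{A_0}n}$. It is normal if all $A_i$ are simple $k$-algebras. The corresponding $k$-pre-modulation of $k(Q,\mathcal A)$ is $(A_i,{}_iM_j)$, of the induced valued quiver $(Q_0,\mathcal D,\Omega)$: vertex set $Q_0$, a unique oriented edge $i\to j$ whenever ${}_iM_j\ne0$, with valuation $(d_{ij},d_{ji})$, $d_{ij}=\mathrm{rank}(({}_iM_j)_{A_j})$, $d_{ji}=\mathrm{rank}({}_{A_i}({}_iM_j))$ (rank = minimal number of generators). Two such pre-modulations $(A_i,{}_iM_j)$ of $(Q_0,\mathcal D,\Omega)$ and $(B_i,{}_iN_j)$ of $(P_0,\mathcal C,\Psi)$ are isomorphic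 if there is a bijection $\theta:Q_0\to P_0$ which is an isomorphism of the directed graphs, with $d_{ij}=c_{\theta(i)\theta(j)}$ and $d_{ji}=c_{\theta(j)\theta(i)}$, and such that $A_i\cong B_{\theta(i)}$ as $k$-algebras and ${}_iM_j\cong{}_{\theta(i)}N_{\theta(j)}$ as bimodules (through these algebra isomorphisms) for all $(i,j)\in Q_0\times Q_0$. *)

(* Defs.v *)
From HB Require Import structures.
From mathcomp Require Import all_boot all_order all_algebra all_field.
From mathcomp Require Import boolp.
From mathcomp.multinomials Require Import freeg.

Set Implicit Arguments.
Unset Strict Implicit.
Unset Printing Implicit Defensive.

Import GRing.Theory.
Local Open Scope ring_scope.

(* R-S-bimodules: the left action is the lmodType structure, the right action
   is ract. *)
Record bimodule (R S : pzRingType) := Bimodule {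
  bimod_sort :> lmodType R;
  ract : bimod_sort -> S -> bimod_sort;
  ract1 : forall m, ract m 1 = m;
  ractA : forall m s t, ract (ract m s) t = ract m (s * t);
  ractDl : forall m m' s, ract (m + m') s = ract m s + ract m' s;
  ractDr : forall m s t, ract m (s + t) = ract m s + ract m t;
  ractZ : forall r m s, ract (r *: m) s = r *: ract m s
}.

Definition balanced (R S : pzRingType) (M : bimodule R S) (N : lmodType S)
    (V : zmodType) (f : M -> N -> V) :=
  [/\ forall m m' n, f (m + m') n = f m n + f m' n,
      forall m n n', f m (n + n') = f m n + f m n' &
      forall m s n, f (ract m s) n = f m (s *: n)].

(* The balanced tensor product of M and N over S: the free abelian group on
   M * N modulo the subgroup generated by the biadditivity and balancing
   relations; it keeps the left R-action of M. *)
Section Tensor.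
Variables (R S : pzRingType) (M : bimodule R S) (N : lmodType S).

Definition formal := {freeg (bimod_sort M * N)%type / int}.
HB.instance Definition _ := GRing.Zmodule.on formal.
Definition fpure (m : M) (n : N) : formal := << (m, n) >>.

Inductive tens_rel : formal -> Prop :=
| TensRel0 : tens_rel 0
| TensRelB x y of tens_rel x & tens_rel y : tens_rel (x - y)
| TensRelDl m m' n : tens_rel (fpure (m + m') n - (fpure m n + fpure m' n))
| TensRelDr m n n' : tens_rel (fpure m (n + n') - (fpure m n + fpure m n'))
| TensRelA m s n : tens_rel (fpure (ract m s) n - fpure m (s *: n)).

Definition tens_null : {pred formal} := fun x => `[< tens_rel x >].

Lemma tens_null_closed : zmod_closed tens_null.
Proof.
split=> [|x y]; rewrite !unfold_in; first exact/asboolP/TensRel0.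
by move=> /asboolP x0 /asboolP y0; apply/asboolP/TensRelB.
Qed.
HB.instance Definition _ :=
  GRing.isZmodClosed.Build formal tens_null tens_null_closed.

Definition tens := Quotient.quot tens_null.
HB.instance Definition _ := Quotient.on tens.
HB.instance Definition _ := GRing.Zmodule.on tens.

Definition tpi (x : formal) : tens := \pi_(Quotient.quot tens_null)%qT x.
Definition tpure (m : M) (n : N) : tens := tpi (fpure m n).

Lemma tpiD x y : tpi (x + y) = tpi x + tpi y.
Proof. by rewrite /tpi !piE. Qed.
Lemma tpiB x y : tpi (x - y) = tpi x - tpi y.
Proof. by rewrite /tpi !piE. Qed.

Lemma tpi_eq x y : tens_rel (x - y) <-> tpi x = tpi y.
Proof.
split=> [xy|/eqP]; rewrite /tpi; last first.
  by rewrite -Quotient.idealrBE unfold_in => /asboolP.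
by apply/eqP; rewrite -Quotient.idealrBE unfold_in; apply/asboolP.
Qed.

Lemma balanced_tpure : balanced tpure.
Proof.
split=> *; rewrite /tpure -?tpiD; apply/tpi_eq.
- exact: TensRelDl.
- exact: TensRelDr.
- exact: TensRelA.
Qed.

Lemma freeg_sum_ind (T : choiceType) (P : {freeg T / int} -> Prop) :
  P 0 -> (forall x y, P x -> P y -> P (x - y)) -> (forall t, P << t >>) ->
  forall x, P x.
Proof.
move=> P0 PB P1.
have PN x : P x -> P (- x) by move=> Px; rewrite -[- x]add0r; apply: PB.
have PD x y : P x -> P y -> P (x + y).
  by move=> Px Py; rewrite -[y]opprK; apply: PB => //; apply: PN.
move=> x; rewrite -[x]freeg_sumE; apply: (big_ind P) => // t _.
have Pn n u : P (<< n%:Z *g u >>).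
  by rewrite -natz -freegU_muln; elim: n => [|n IH]; rewrite ?mulr0n // mulrS; apply: PD.
case: (coeff t x) => n; first exact: Pn.
by rewrite NegzE -freegUN; apply: PN.
Qed.

Lemma tens_ind (P : tens -> Prop) :
  P 0 -> (forall x y, P x -> P y -> P (x - y)) ->
  (forall m n, P (tpure m n)) -> forall t, P t.
Proof.
move=> P0 PB Pp t; suff Px x : P (tpi x) by rewrite -[t]reprK; exact: Px.
elim/freeg_sum_ind: x => [|x y Px Py|[m n]]; last exact: Pp.
- by rewrite -[0](subrr 0) tpiB subrr.
- by rewrite tpiB; apply: PB.
Qed.

Section Lift.
Variables (V : zmodType) (f : M -> N -> V).

Definition flift (x : formal) : V :=
  fglift ((fun p => f p.1 p.2) : M * N -> ssrint.zmodule V) x.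
Definition tlift (t : tens) : V := flift (repr (t : Quotient.quot tens_null)).

Lemma fliftB x y : flift (x - y) = flift x - flift y.
Proof.
exact: (@lift_is_additive int _ (ssrint.zmodule V) (fun p => f p.1 p.2) x y).
Qed.
Lemma flift0 : flift 0 = 0.
Proof. by rewrite -[X in flift X](subrr 0) fliftB subrr. Qed.
Lemma fliftD x y : flift (x + y) = flift x + flift y.
Proof. by rewrite -{1}[y]opprK fliftB -[- y]add0r fliftB flift0 add0r opprK. Qed.
Lemma flift_pure m n : flift (fpure m n) = f m n.
Proof. by rewrite /flift liftU scale1r. Qed.

Hypothesis fP : balanced f.

Lemma flift_rel x : tens_rel x -> flift x = 0.
Proof.
case: fP => fDl fDr fA.
elim=> [|{}x y _ x0 _ y0|m m' n|m n n'|m s n].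
- exact: flift0.
- by rewrite fliftB x0 y0 subr0.
- by rewrite fliftB fliftD !flift_pure fDl subrr.
- by rewrite fliftB fliftD !flift_pure fDr subrr.
- by rewrite fliftB !flift_pure fA subrr.
Qed.

Lemma tlift_pi x : tlift (tpi x) = flift x.
Proof.
apply/eqP; rewrite -subr_eq0 -fliftB; apply/eqP/flift_rel/tpi_eq.
exact: reprK.
Qed.

Lemma tlift_pure m n : tlift (tpure m n) = f m n.
Proof. by rewrite tlift_pi flift_pure. Qed.

Lemma tliftB x y : tlift (x - y) = tlift x - tlift y.
Proof.
have tpiK (t : tens) : t = tpi (repr (t : Quotient.quot tens_null)).
  by rewrite /tpi reprK.
by rewrite [x]tpiK [y]tpiK -tpiB !tlift_pi fliftB.
Qed.
End Lift.
End Tensor.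

Lemma tens_ext (R S : pzRingType) (M : bimodule R S) (N : lmodType S)
    (V : zmodType) (f g : tens M N -> V) :
    {morph f : x y / x - y} -> {morph g : x y / x - y} ->
    (forall m n, f (tpure m n) = g (tpure m n)) -> f =1 g.
Proof.
move=> fB gB fg; elim/tens_ind=> [|x y fgx fgy|//].
- by rewrite -(subrr 0) fB gB !subrr.
- by rewrite fB gB fgx fgy.
Qed.

Lemma morphB_D (U V : zmodType) (f : U -> V) :
  {morph f : x y / x - y} -> {morph f : x y / x + y}.
Proof.
move=> fB x y; have f0 : f 0 = 0 by rewrite -[0](subrr 0) fB subrr.
by rewrite -{1}[y]opprK fB -[- y]add0r fB f0 add0r opprK.
Qed.

Section TensModule.
Variables (R S : pzRingType) (M : bimodule R S) (N : lmodType S).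

Lemma tpureDl (m m' : M) (n : N) : tpure (m + m') n = tpure m n + tpure m' n.
Proof. by case: (balanced_tpure M N). Qed.
Lemma tpureDr (m : M) (n n' : N) : tpure m (n + n') = tpure m n + tpure m n'.
Proof. by case: (balanced_tpure M N). Qed.
Lemma tpureA (m : M) (s : S) (n : N) : tpure (ract m s) n = tpure m (s *: n).
Proof. by case: (balanced_tpure M N). Qed.
Lemma tpure0r (m : M) : tpure m (0 : N) = 0.
Proof. by apply: (addrI (tpure m 0)); rewrite -tpureDr !addr0. Qed.

Definition tscale (r : R) : tens M N -> tens M N :=
  tlift (fun m n => tpure (r *: m) n).

Lemma balanced_scale r : balanced (fun (m : M) (n : N) => tpure (r *: m) n).
Proof.
split=> *; first by rewrite scalerDr tpureDl.
- exact: tpureDr.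
- by rewrite -ractZ tpureA.
Qed.

Lemma tscale_pure r (m : M) (n : N) : tscale r (tpure m n) = tpure (r *: m) n.
Proof. exact/tlift_pure/balanced_scale. Qed.

Lemma tscaleB r : {morph tscale r : x y / x - y}.
Proof. by move=> x y; apply/tliftB/balanced_scale. Qed.

Lemma tscaleA r s t : tscale r (tscale s t) = tscale (r * s) t.
Proof.
move: t; apply: tens_ext => [x y|x y|m n]; rewrite ?tscaleB //.
by rewrite !tscale_pure scalerA.
Qed.

Lemma tscale1 : left_id 1 tscale.
Proof.
apply: tens_ext => [x y|//|m n]; rewrite ?tscaleB //.
by rewrite tscale_pure scale1r.
Qed.

Lemma tscaleDr : right_distributive tscale +%R.
Proof. by move=> r; apply/morphB_D/tscaleB. Qed.

Lemma tscaleDl t : {morph tscale^~ t : r s / r + s}.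
Proof.
move=> r s; move: t; apply: tens_ext => [x y|x y|m n].
- exact: tscaleB.
- by rewrite !tscaleB opprD addrACA.
- by rewrite !tscale_pure scalerDl tpureDl.
Qed.

HB.instance Definition _ := GRing.Zmodule_isLmodule.Build R (tens M N)
  tscaleA tscale1 tscaleDr tscaleDl.

Lemma scale_tpure r (m : M) (n : N) : r *: tpure m n = tpure (r *: m) n.
Proof. exact: tscale_pure. Qed.
End TensModule.

(* The tensor algebra of the A-A-bimodule M: the direct sum over n of the
   n-fold tensor powers tpow n of M over A, with tpow 0 = A. *)
Section TensorAlgebra.
Variables (A : pzRingType) (M : bimodule A A).

Fixpoint tpow (n : nat) : lmodType A :=
  if n is n'.+1 then tens M (tpow n') else A^o.

Record talg := TAlg {
  tcomp :> forall n, tpow n;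
  tcomp_fin : exists N, forall n, (N <= n)%N -> tcomp n = 0
}.

HB.instance Definition _ := gen_eqMixin talg.
HB.instance Definition _ := gen_choiceMixin talg.

Lemma talgP (x y : talg) : (forall n, x n = y n) -> x = y.
Proof.
case: x y => [x xN] [y yN] /= xy; have e : x = y by apply: functional_extensionality_dep.
by case: _ / e yN => yN; congr TAlg; apply: Prop_irrelevance.
Qed.

Fact talg_zero_fin : exists N, forall n, (N <= n)%N -> (0 : tpow n) = 0.
Proof. by exists 0%N. Qed.
Definition talg_zero := TAlg talg_zero_fin.

Fact talg_opp_fin (x : talg) :
  exists N, forall n, (N <= n)%N -> - x n = 0.
Proof. by case: x => x [N xN]; exists N => n /xN /= ->; rewrite oppr0. Qed.
Definition talg_opp (x : talg) := TAlg (talg_opp_fin x).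

Fact talg_add_fin (x y : talg) :
  exists N, forall n, (N <= n)%N -> x n + y n = 0.
Proof.
case: x y => [x [N xN]] [y [N' yN]]; exists (maxn N N') => n.
by rewrite geq_max => /andP[/xN /= -> /yN /= ->]; rewrite addr0.
Qed.
Definition talg_add (x y : talg) := TAlg (talg_add_fin x y).

Fact talg_addA : associative talg_add.
Proof. by move=> x y z; apply: talgP => n; apply: addrA. Qed.
Fact talg_addC : commutative talg_add.
Proof. by move=> x y; apply: talgP => n; apply: addrC. Qed.
Fact talg_add0 : left_id talg_zero talg_add.
Proof. by move=> x; apply: talgP => n; apply: add0r. Qed.
Fact talg_addN : left_inverse talg_zero talg_opp talg_add.
Proof. by move=> x; apply: talgP => n; apply: addNr. Qed.
HB.instance Definition _ := GRing.isZmodule.Build talg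
  talg_addA talg_addC talg_add0 talg_addN.

Lemma talgD (x y : talg) n : (x + y) n = x n + y n. Proof. by []. Qed.
Lemma talgB (x y : talg) n : (x - y) n = x n - y n. Proof. by []. Qed.
Lemma talg0 n : (0 : talg) n = 0. Proof. by []. Qed.
Lemma talg_sum (I : Type) (r : seq I) (P : pred I) (F : I -> talg) n :
  (\sum_(i <- r | P i) F i) n = \sum_(i <- r | P i) F i n.
Proof. by elim/big_rec2: _ => // i y1 y2 _ <-. Qed.

Fact talg_scale_fin (a : A) (x : talg) :
  exists N, forall n, (N <= n)%N -> a *: x n = 0.
Proof. by case: x => x [N xN]; exists N => n /xN /= ->; rewrite scaler0. Qed.
Definition talg_scale a (x : talg) := TAlg (talg_scale_fin a x).

Fact talg_scaleA a b x : talg_scale a (talg_scale b x) = talg_scale (a * b) x.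
Proof. by apply: talgP => n; apply: scalerA. Qed.
Fact talg_scale1 : left_id 1 talg_scale.
Proof. by move=> x; apply: talgP => n; apply: scale1r. Qed.
Fact talg_scaleDr : right_distributive talg_scale +%R.
Proof. by move=> a x y; apply: talgP => n; apply: scalerDr. Qed.
Fact talg_scaleDl x : {morph talg_scale^~ x : a b / a + b}.
Proof. by move=> a b; apply: talgP => n; apply: scalerDl. Qed.
HB.instance Definition _ := GRing.Zmodule_isLmodule.Build A talg
  talg_scaleA talg_scale1 talg_scaleDr talg_scaleDl.

(* tins m x is m (x) x, i.e. the product of m, in degree 1, with x; see
   tmul_ins. *)
Fact tins_fin (m : M) (x : talg) :
  exists N, forall n, (N <= n)%N ->
    (if n is n'.+1 return tpow n then tpure m (x n') else 0) = 0.
Proof.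
case: x => x [N xN]; exists N.+1 => -[//|n] /xN /= ->.
exact: tpure0r.
Qed.
Definition tins (m : M) (x : talg) : talg := TAlg (tins_fin m x).

Lemma tinsDl m m' x : tins (m + m') x = tins m x + tins m' x.
Proof.
apply: talgP => -[|n]; first by rewrite talgD /= addr0.
exact: tpureDl.
Qed.
Lemma tinsDr m x y : tins m (x + y) = tins m x + tins m y.
Proof.
apply: talgP => -[|n]; first by rewrite talgD /= addr0.
exact: tpureDr.
Qed.
Lemma tins0 m : tins m 0 = 0.
Proof. by apply: (addrI (tins m 0)); rewrite -tinsDr !addr0. Qed.
Lemma tins_sum m (I : Type) (r : seq I) (P : pred I) (F : I -> talg) :
  tins m (\sum_(i <- r | P i) F i) = \sum_(i <- r | P i) tins m (F i).
Proof. exact: (big_morph _ (tinsDr m) (tins0 m)). Qed.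
Lemma tinsA m a x : tins (ract m a) x = tins m (a *: x).
Proof. by apply: talgP => -[//|n]; apply: tpureA. Qed.
Lemma tinsZ a m x : a *: tins m x = tins (a *: m) x.
Proof. by apply: talgP => -[|n]; [apply: scaler0 | apply: scale_tpure]. Qed.

(* Product of the homogeneous element t of degree n with y, determined by
   a . y = a *: y in degree 0 and (m (x) t) . y = m (x) (t . y). *)
Fixpoint tmulc (y : talg) (n : nat) : tpow n -> talg :=
  if n is n'.+1 return tpow n -> talg
  then tlift (fun m t => tins m (tmulc y t)) else fun a => (a : A) *: y.

Lemma tmulc_props y n :
  {morph @tmulc y n : t u / t - u} /\
  (forall a (t : tpow n), tmulc y (a *: t) = a *: tmulc y t).
Proof.
elim: n => [|n [IHB IHZ]].
  split=> [a b|a b]; [exact: scalerBl | exact/esym/scalerA].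
have bal : balanced (fun m t => tins m (@tmulc y n t)).
  split=> *; first exact: tinsDl.
  - by rewrite (morphB_D IHB) tinsDr.
  - by rewrite tinsA IHZ.
have B : {morph @tmulc y n.+1 : t u / t - u} by move=> t u; apply: tliftB.
split=> // a; apply: tens_ext => [t u|t u|m t].
- by rewrite scalerBr B.
- by rewrite B scalerBr.
- by rewrite scale_tpure /= !tlift_pure // tinsZ.
Qed.

Lemma tmulcB y n : {morph @tmulc y n : t u / t - u}.
Proof. by case: (tmulc_props y n). Qed.
Lemma tmulcD y n : {morph @tmulc y n : t u / t + u}.
Proof. exact/morphB_D/tmulcB. Qed.
Lemma tmulc0 y n : @tmulc y n 0 = 0.
Proof. by rewrite -(subrr 0) tmulcB subrr. Qed.
Lemma tmulcZ y n a (t : tpow n) : tmulc y (a *: t) = a *: tmulc y t.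
Proof. by case: (tmulc_props y n) => _ ->. Qed.
Lemma tmulcS y n m (t : tpow n) :
  @tmulc y n.+1 (tpure m t) = tins m (tmulc y t).
Proof.
have bal : balanced (fun m t => tins m (@tmulc y n t)).
  split=> *; first exact: tinsDl.
  - by rewrite tmulcD tinsDr.
  - by rewrite tinsA tmulcZ.
exact: (tlift_pure bal).
Qed.

Lemma tmulcDl y y' n (t : tpow n) :
  tmulc (y + y') t = tmulc y t + tmulc y' t.
Proof.
elim: n t => [a|n IH]; first exact: scalerDr.
apply: tens_ext => [t u|t u|m t].
- exact: (@tmulcB _ n.+1).
- by rewrite !(@tmulcB _ n.+1) opprD addrACA.
- by rewrite !tmulcS IH tinsDr.
Qed.

Definition tbound (x : talg) : nat := sval (cid (tcomp_fin x)).
Definition tmul (x y : talg) : talg := \sum_(n < tbound x) tmulc y (x n).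

Lemma tmulE (x y : talg) N : (forall n, (N <= n)%N -> x n = 0) ->
  tmul x y = \sum_(n < N) tmulc y (x n).
Proof.
have aux N1 N2 : (N1 <= N2)%N -> (forall n, (N1 <= n)%N -> x n = 0) ->
    \sum_(n < N1) tmulc y (x n) = \sum_(n < N2) tmulc y (x n).
  move=> le12 x0; rewrite -!(big_mkord xpredT (fun n => tmulc y (x n))).
  rewrite [RHS](big_cat_nat (leq0n _) le12) /= [X in _ + X]big_nat_cond.
  rewrite [X in _ + X]big1 ?addr0 // => n /andP[/andP[/x0-> _] _].
  exact: tmulc0.
rewrite /tmul /tbound; case: cid => N' /= xN' xN.
by rewrite (aux _ _ (leq_maxl N' N) xN') [RHS](aux _ _ (leq_maxr N' N) xN).
Qed.

Lemma tmulDl : left_distributive tmul +%R.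
Proof.
move=> x x' y; have [N xN] := tcomp_fin x; have [N' xN'] := tcomp_fin x'.
have x0 n : (maxn N N' <= n)%N -> x n = 0.
  by rewrite geq_max => /andP[/xN].
have x'0 n : (maxn N N' <= n)%N -> x' n = 0.
  by rewrite geq_max => /andP[_ /xN'].
have xx'0 n : (maxn N N' <= n)%N -> (x + x') n = 0.
  by move=> le; rewrite talgD x0 // x'0 // addr0.
rewrite (tmulE y x0) (tmulE y x'0) (tmulE y xx'0) -big_split /=.
by apply: eq_bigr => n _; apply: tmulcD.
Qed.

Lemma tmulDr : right_distributive tmul +%R.
Proof.
move=> x y y'; rewrite /tmul -big_split /=.
by apply: eq_bigr => n _; apply: tmulcDl.
Qed.

Lemma tmul0l y : tmul 0 y = 0.
Proof. by apply: (addrI (tmul 0 y)); rewrite -tmulDl !addr0. Qed.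

Lemma tmul_scale a x y : tmul (a *: x) y = a *: tmul x y.
Proof.
have [N xN] := tcomp_fin x.
have axN n : (N <= n)%N -> (a *: x) n = 0.
  by move=> /xN xn0; rewrite -[LHS]/(a *: x n) xn0 scaler0.
rewrite (tmulE y xN) (tmulE y axN) scaler_sumr.
by apply: eq_bigr => n _; apply: tmulcZ.
Qed.

Lemma tmul_ins m x y : tmul (tins m x) y = tins m (tmul x y).
Proof.
have [N xN] := tcomp_fin x.
have ixN n : (N.+1 <= n)%N -> tins m x n = 0.
  by case: n => [//|n] /xN /= ->; rewrite tpure0r.
rewrite (tmulE y xN) (tmulE y ixN) big_ord_recl tmulc0 add0r tins_sum.
by apply: eq_bigr => n _; apply: tmulcS.
Qed.

Lemma tmulc_mul y z n (t : tpow n) : tmul (tmulc y t) z = tmulc (tmul y z) t.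
Proof.
elim: n t => [a|n IH]; first exact: tmul_scale.
have mB w : {morph tmul^~ w : x y / x - y}.
  move=> u v; apply: (addIr (tmul v w)).
  by rewrite -tmulDl subrK subrK.
apply: tens_ext => [t u|t u|m t].
- by rewrite (@tmulcB _ n.+1) mB.
- exact: (@tmulcB _ n.+1).
- by rewrite !tmulcS tmul_ins IH.
Qed.

Lemma tmulA : associative tmul.
Proof.
move=> x y z; rewrite [tmul x y]/tmul.
rewrite (big_morph (tmul^~ z) (fun u v => tmulDl u v z) (tmul0l z)).
by apply: eq_bigr => n _; rewrite tmulc_mul.
Qed.

Fact talg_one_fin : exists N, forall n, (N <= n)%N ->
  (if n is 0%N return tpow n then 1 : A else 0) = 0.
Proof. by exists 1%N => -[]. Qed.
Definition talg_one : talg := TAlg talg_one_fin.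

Lemma tmul1l : left_id talg_one tmul.
Proof.
move=> x; have oneN n : (1 <= n)%N -> talg_one n = 0 by case: n.
rewrite (tmulE x oneN) big_ord_recl big_ord0 addr0.
exact: scale1r.
Qed.

Lemma tmulc1_diag n (t : tpow n) : tmulc talg_one t n = t.
Proof.
elim: n t => [a|n IH]; first by rewrite /= -[LHS]/(a * 1) mulr1.
apply: tens_ext => [t u|//|m t]; first by rewrite (@tmulcB _ n.+1).
by rewrite tmulcS /= IH.
Qed.

Lemma tmulc1_off n (t : tpow n) j : j != n -> tmulc talg_one t j = 0.
Proof.
elim: n t j => [a [//|j] _|n IH t j jn]; first exact: scaler0.
move: t; apply: tens_ext => [t u|t u|m t]; rewrite ?subr0 //.
  by rewrite (@tmulcB _ n.+1).
rewrite tmulcS; case: j jn => [//|j]; rewrite eqSS => jn.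
by rewrite /= IH // tpure0r.
Qed.

Lemma tmul1r : right_id talg_one tmul.
Proof.
move=> x; apply: talgP => j; have [N xN] := tcomp_fin x.
have x0 n : (maxn N j.+1 <= n)%N -> x n = 0 by rewrite geq_max => /andP[/xN].
rewrite (tmulE _ x0) talg_sum.
have lt_j : (j < maxn N j.+1)%N by rewrite leq_max leqnn orbT.
rewrite (bigD1 (Ordinal lt_j)) //= tmulc1_diag big1 ?addr0 // => n nj.
by apply: tmulc1_off; rewrite eq_sym.
Qed.

HB.instance Definition _ := GRing.Zmodule_isPzRing.Build talg
  tmulA tmul1l tmul1r tmulDl tmulDr.

End TensorAlgebra.

Section FreeBimodule.
Variables (k : fieldType) (A B : falgType k).

(* A as an A-k-bimodule, so that tensoring it with B over k gives A (x)_k B. *)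
Definition reg_act (a : A^o) (c : k) : A^o := c *: (a : A).
Fact reg_act1 a : reg_act a 1 = a. Proof. exact: (@scale1r k A a). Qed.
Fact reg_actA a c d : reg_act (reg_act a c) d = reg_act a (c * d).
Proof. by rewrite mulrC; apply: (@scalerA k A d c a). Qed.
Fact reg_actDl a a' c : reg_act (a + a') c = reg_act a c + reg_act a' c.
Proof. exact: (@scalerDr k A c a a'). Qed.
Fact reg_actDr a c d : reg_act a (c + d) = reg_act a c + reg_act a d.
Proof. exact: (@scalerDl k A a c d). Qed.
Fact reg_actZ (r : A) a c : reg_act (r *: a) c = r *: reg_act a c.
Proof. exact: (@scalerAr k A c r a). Qed.
Definition reg_bimod : bimodule A k :=
  Bimodule reg_act1 reg_actA reg_actDl reg_actDr reg_actZ.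

Definition bitens : lmodType A := tens reg_bimod B.

Definition bipure (a : A) (b : B) : bitens := @tpure A k reg_bimod B a b.

Definition bitens_ract (t : bitens) (b : B) : bitens :=
  @tlift A k reg_bimod B _ (fun x y => bipure x (y * b)) t.

Lemma bitens_bal b : balanced (fun (x : reg_bimod) (y : B) => bipure x (y * b)).
Proof.
split=> *; first exact: tpureDl.
- by rewrite mulrDl; apply: tpureDr.
- by rewrite -scalerAl; apply: tpureA.
Qed.
Lemma bitens_ract_pure x y b : bitens_ract (bipure x y) b = bipure x (y * b).
Proof. exact: (tlift_pure (bitens_bal b)). Qed.
Lemma bitens_ractB b : {morph bitens_ract^~ b : x y / x - y}.
Proof. by move=> x y; apply: (tliftB (bitens_bal b)). Qed.
Lemma bitens_scale a x y : a *: bipure x y = bipure (a * x) y.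
Proof. exact: scale_tpure. Qed.

Fact bitens_ract1 t : bitens_ract t 1 = t.
Proof.
move: t; apply: tens_ext => [x y|//|x y]; first exact: bitens_ractB.
by rewrite bitens_ract_pure mulr1.
Qed.
Fact bitens_ractA t b c : bitens_ract (bitens_ract t b) c = bitens_ract t (b * c).
Proof.
move: t; apply: tens_ext => [x y|x y|x y]; rewrite ?bitens_ractB //.
by rewrite !bitens_ract_pure mulrA.
Qed.
Fact bitens_ractDl t u b : bitens_ract (t + u) b = bitens_ract t b + bitens_ract u b.
Proof. exact: (morphB_D (bitens_ractB b)). Qed.
Fact bitens_ractDr t b c : bitens_ract t (b + c) = bitens_ract t b + bitens_ract t c.
Proof.
move: t; apply: tens_ext => [x y|x y|x y]; rewrite ?bitens_ractB //.
  by rewrite opprD addrACA.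
by rewrite !bitens_ract_pure mulrDr; apply: tpureDr.
Qed.
Fact bitens_ractZ a t b : bitens_ract (a *: t) b = a *: bitens_ract t b.
Proof.
move: t; apply: tens_ext => [x y|x y|x y].
- by rewrite scalerBr bitens_ractB.
- by rewrite bitens_ractB scalerBr.
- by rewrite bitens_scale !bitens_ract_pure bitens_scale.
Qed.

Variable (E : finType).

(* The free A-B-bimodule on the basis E: one copy of A (x)_k B per element. *)

Definition freebi_ract (f : {ffun E -> bitens}) (b : B) : {ffun E -> bitens} :=
  [ffun e => bitens_ract (f e) b].
Fact freebi_ract1 f : freebi_ract f 1 = f.
Proof. by apply/ffunP => e; rewrite ffunE bitens_ract1. Qed.
Fact freebi_ractA f b c : freebi_ract (freebi_ract f b) c = freebi_ract f (b * c).
Proof. by apply/ffunP => e; rewrite !ffunE bitens_ractA. Qed.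
Fact freebi_ractDl f g b : freebi_ract (f + g) b = freebi_ract f b + freebi_ract g b.
Proof. by apply/ffunP => e; rewrite !ffunE bitens_ractDl. Qed.
Fact freebi_ractDr f b c : freebi_ract f (b + c) = freebi_ract f b + freebi_ract f c.
Proof. by apply/ffunP => e; rewrite !ffunE bitens_ractDr. Qed.
Fact freebi_ractZ a f b : freebi_ract (a *: f) b = a *: freebi_ract f b.
Proof. by apply/ffunP => e; rewrite !ffunE bitens_ractZ. Qed.
Definition freebi : bimodule A B :=
  Bimodule freebi_ract1 freebi_ractA freebi_ractDl freebi_ractDr freebi_ractZ.

Lemma freebi_central c (m : freebi) : c%:A *: m = ract m c%:A.
Proof.
apply/ffunP => e; rewrite /= !ffunE; move: (m e).
apply: tens_ext => [x y|x y|x y]; [exact: scalerBr | exact: bitens_ractB |].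
rewrite bitens_ract_pure bitens_scale mulr_algl -scalerAr mulr1.
exact: (@tpureA A k reg_bimod B).
Qed.
End FreeBimodule.

Section Generation.
Variables (R S : pzRingType) (M : bimodule R S).
Definition gen_left n :=
  exists g : 'I_n -> M, forall m, exists r : 'I_n -> R, m = \sum_i r i *: g i.
Definition gen_right n :=
  exists g : 'I_n -> M, forall m, exists s : 'I_n -> S,
    m = \sum_i ract (g i) (s i).

(* The ranks are minimal numbers of generators. *)
Definition fg_left := exists n, `[< gen_left n >].
Definition fg_right := exists n, `[< gen_right n >].
Definition rank_left (fg : fg_left) : nat := ex_minn fg.
Definition rank_right (fg : fg_right) : nat := ex_minn fg.

Lemma fg_leftP (I : finType) (g : I -> M) :
  (forall m, exists r : I -> R, m = \sum_i r i *: g i) -> fg_left.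
Proof.
move=> gP; exists #|I|; apply/asboolP; exists (g \o enum_val) => m.
have [r ->] := gP m; exists (r \o enum_val).
by rewrite (reindex (@enum_val I predT)) //=; apply/onW_bij/enum_val_bij.
Qed.
Lemma fg_rightP (I : finType) (g : I -> M) :
  (forall m, exists s : I -> S, m = \sum_i ract (g i) (s i)) -> fg_right.
Proof.
move=> gP; exists #|I|; apply/asboolP; exists (g \o enum_val) => m.
have [r ->] := gP m; exists (r \o enum_val).
by rewrite (reindex (@enum_val I predT)) //=; apply/onW_bij/enum_val_bij.
Qed.
End Generation.

Section FreeBimoduleFG.
Variables (k : fieldType) (A B : falgType k) (E : finType).
Local Notation F := (freebi A B E).

Lemma tpure_sumr (R S : pzRingType) (M : bimodule R S) (N : lmodType S)
  (m : M) (I : Type) (r : seq I) (P : pred I) (G : I -> N) :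
  tpure m (\sum_(i <- r | P i) G i) = \sum_(i <- r | P i) tpure m (G i).
Proof. exact: (big_morph _ (tpureDr m) (tpure0r N m)). Qed.

Let nA : nat := \dim {:A}.
Let nB : nat := \dim {:B}.

Lemma bitens_fgl (t : bitens A B) :
  exists r : 'I_nB -> A, t = \sum_i r i *: bipure (1 : A) (vbasis {:B})`_i.
Proof.
elim/tens_ind: t => [|x y [r ->] [s ->]|a b].
- by exists (fun _ => 0); rewrite big1 // => i _; rewrite scale0r.
- exists (fun i => r i - s i); rewrite -sumrB.
  by apply: eq_bigr => i _; rewrite scalerBl.
exists (fun i => coord (vbasis {:B}) i b *: a).
rewrite {1}(coord_vbasis (memvf b)) tpure_sumr.
apply: eq_bigr => i _; rewrite bitens_scale mulr1.
exact/esym/(@tpureA A k (reg_bimod A) B).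
Qed.

Lemma bitens_fgr (t : bitens A B) :
  exists s : 'I_nA -> B,
    t = \sum_(i < nA) bitens_ract (bipure (vbasis {:A})`_i (1 : B)) (s i).
Proof.
elim/tens_ind: t => [|x y [r ->] [s ->]|a b].
- exists (fun _ => 0); rewrite big1 // => i _.
  by rewrite bitens_ract_pure mulr0; apply: tpure0r.
- exists (fun i => r i - s i); rewrite -sumrB; apply: eq_bigr => i _.
  rewrite -[X in _ = X](addrK (bitens_ract (bipure (vbasis {:A})`_i 1) (s i))).
  by rewrite -bitens_ractDr subrK.
exists (fun i => coord (vbasis {:A}) i a *: b).
have tpureDl' := @tpureDl A k (reg_bimod A) B.
have tpure0l : @tpure A k (reg_bimod A) B 0 b = 0.
  by apply: (addrI (tpure (0 : reg_bimod A) b)); rewrite -tpureDl' !addr0.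
rewrite {1}(coord_vbasis (memvf a)).
rewrite (big_morph (fun x : reg_bimod A => tpure x b)
  (fun x y => tpureDl' x y b) tpure0l).
apply: eq_bigr => i _; rewrite bitens_ract_pure mul1r.
exact: (@tpureA A k (reg_bimod A) B).
Qed.

Definition fdelta (e : E) (t : bitens A B) : F :=
  [ffun e' => if e' == e then t else 0].

Lemma freebi_fgl : fg_left F.
Proof.
apply: (@fg_leftP _ _ F (E * 'I_nB)%type
  (fun p : E * _ => fdelta p.1 (bipure 1 (vbasis {:B})`_p.2))) => f.
pose r e := sval (cid (bitens_fgl (f e))).
have rP e : f e = _ := svalP (cid (bitens_fgl (f e))).
exists (fun p => r p.1 p.2).
apply/ffunP => e; rewrite sum_ffunE.
rewrite -(pair_bigA _ (fun e' (i : 'I__) =>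
  (r e' i *: fdelta e' (bipure 1 (vbasis {:B})`_i)) e)) /=.
rewrite (bigD1 e) //= [X in _ + X]big1 ?addr0 => [|e' ne].
  by rewrite [LHS]rP; apply: eq_bigr => i _; rewrite !ffunE eqxx.
by apply: big1 => i _; rewrite !ffunE eq_sym (negPf ne) scaler0.
Qed.

Lemma freebi_fgr : fg_right F.
Proof.
apply: (@fg_rightP _ _ F (E * 'I_nA)%type
  (fun p : E * _ => fdelta p.1 (bipure (vbasis {:A})`_p.2 1))) => f.
pose r e := sval (cid (bitens_fgr (f e))).
have rP e : f e = _ := svalP (cid (bitens_fgr (f e))).
exists (fun p => r p.1 p.2).
apply/ffunP => e; rewrite sum_ffunE.
rewrite -(pair_bigA _ (fun e' (i : 'I__) =>
  ract (fdelta e' (bipure (vbasis {:A})`_i 1)) (r e' i) e)) /=.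
rewrite (bigD1 e) //= [X in _ + X]big1 ?addr0 => [|e' ne].
  by rewrite [LHS]rP; apply: eq_bigr => i _; rewrite !ffunE eqxx.
have r0 b : bitens_ract (0 : bitens A B) b = 0.
  by rewrite -[X in bitens_ract X](subrr 0) bitens_ractB subrr.
by rewrite big1 // => i _; rewrite !ffunE eq_sym (negPf ne) r0.
Qed.
End FreeBimoduleFG.

Record quiver := Quiver {
  qvert : finType;
  qarr : finType;
  qsrc : qarr -> qvert;
  qtgt : qarr -> qvert
}.

Definition arrows (Q : quiver) (i j : qvert Q) : finType :=
  {a : qarr Q | (qsrc a == i) && (qtgt a == j)}.

(* An falgType is non-zero by construction, so only ideals need be considered. *)
Definition simple_alg (k : fieldType) (A : falgType k) :=
  forall I : {vspace A},
    (forall a x, x \in I -> a * x \in I /\ x * a \in I) ->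
    I = 0%VS \/ I = fullv.

Section BaseAlgebra.
Variables (k : fieldType) (V : finType) (A : V -> falgType k).

(* The product of the A i. It is only a possibly zero ring since V may be
   empty, which is why the MathComp algebra structures (whose carriers are
   non-zero rings) are not used for it nor for gpa below. *)
Definition gpa_base := {dffun forall i : V, A i}.
HB.instance Definition _ := Choice.on gpa_base.

Definition base_zero : gpa_base := finfun (fun i => 0 : A i).
Definition base_opp (x : gpa_base) : gpa_base := finfun (fun i => - x i).
Definition base_add (x y : gpa_base) : gpa_base := finfun (fun i => x i + y i).
Definition base_one : gpa_base := finfun (fun i => 1 : A i).
Definition base_mul (x y : gpa_base) : gpa_base := finfun (fun i => x i * y i).

Fact base_addA : associative base_add.
Proof. by move=> x y z; apply/ffunP => i; rewrite !ffunE addrA. Qed.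
Fact base_addC : commutative base_add.
Proof. by move=> x y; apply/ffunP => i; rewrite !ffunE addrC. Qed.
Fact base_add0 : left_id base_zero base_add.
Proof. by move=> x; apply/ffunP => i; rewrite !ffunE add0r. Qed.
Fact base_addN : left_inverse base_zero base_opp base_add.
Proof. by move=> x; apply/ffunP => i; rewrite !ffunE addNr. Qed.
HB.instance Definition _ := GRing.isZmodule.Build gpa_base
  base_addA base_addC base_add0 base_addN.

Fact base_mulA : associative base_mul.
Proof. by move=> x y z; apply/ffunP => i; rewrite !ffunE mulrA. Qed.
Fact base_mul1l : left_id base_one base_mul.
Proof. by move=> x; apply/ffunP => i; rewrite !ffunE mul1r. Qed.
Fact base_mul1r : right_id base_one base_mul.
Proof. by move=> x; apply/ffunP => i; rewrite !ffunE mulr1. Qed.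
Fact base_mulDl : left_distributive base_mul +%R.
Proof. by move=> x y z; apply/ffunP => i; rewrite !ffunE mulrDl. Qed.
Fact base_mulDr : right_distributive base_mul +%R.
Proof. by move=> x y z; apply/ffunP => i; rewrite !ffunE mulrDr. Qed.
HB.instance Definition _ := GRing.Zmodule_isPzRing.Build gpa_base
  base_mulA base_mul1l base_mul1r base_mulDl base_mulDr.

Lemma baseD (x y : gpa_base) i : (x + y) i = x i + y i.
Proof. exact: ffunE. Qed.
Lemma baseM (x y : gpa_base) i : (x * y) i = x i * y i.
Proof. exact: ffunE. Qed.
Lemma base1 i : (1 : gpa_base) i = 1.
Proof. exact: ffunE. Qed.

Definition base_scalar (c : k) : gpa_base := finfun (fun i => c%:A : A i).
Lemma base_scalarE c i : base_scalar c i = c%:A. Proof. exact: ffunE. Qed.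
Lemma base_scalarC c x : x * base_scalar c = base_scalar c * x.
Proof.
by apply/ffunP => i; rewrite !baseM base_scalarE mulr_algl mulr_algr.
Qed.
End BaseAlgebra.

Section GPA.
Variables (k : fieldType) (Q : quiver) (A : qvert Q -> falgType k).

Definition arrow_bimod (i j : qvert Q) : bimodule (A i) (A j) :=
  freebi (A i) (A j) (arrows i j).

(* The direct sum of all the arrow_bimod i j. *)
Definition arrow_sum := {dffun forall p : qvert Q * qvert Q,
  bimod_sort (arrow_bimod p.1 p.2)}.
HB.instance Definition _ := Choice.on arrow_sum.

Implicit Types m : arrow_sum.
Definition asum_zero : arrow_sum :=
  finfun (fun p => 0 : arrow_bimod p.1 p.2).
Definition asum_opp m : arrow_sum := finfun (fun p => - m p).
Definition asum_add m m' : arrow_sum := finfun (fun p => m p + m' p).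
Definition asum_lact (a : gpa_base A) m : arrow_sum :=
  finfun (fun p => a p.1 *: m p).
Definition asum_ract m (a : gpa_base A) : arrow_sum :=
  finfun (fun p => ract (m p) (a p.2)).

Fact asum_addA : associative asum_add.
Proof. by move=> x y z; apply/ffunP => i; rewrite !ffunE addrA. Qed.
Fact asum_addC : commutative asum_add.
Proof. by move=> x y; apply/ffunP => i; rewrite !ffunE addrC. Qed.
Fact asum_add0 : left_id asum_zero asum_add.
Proof. by move=> x; apply/ffunP => i; rewrite !ffunE add0r. Qed.
Fact asum_addN : left_inverse asum_zero asum_opp asum_add.
Proof. by move=> x; apply/ffunP => i; rewrite !ffunE addNr. Qed.
HB.instance Definition _ := GRing.isZmodule.Build arrow_sum
  asum_addA asum_addC asum_add0 asum_addN.

Fact asum_lactA a b m : asum_lact a (asum_lact b m) = asum_lact (a * b) m.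
Proof. by apply/ffunP => p; rewrite !ffunE scalerA. Qed.
Fact asum_lact1 : left_id 1 asum_lact.
Proof. by move=> m; apply/ffunP => p; rewrite !ffunE scale1r. Qed.
Fact asum_lactDr : right_distributive asum_lact +%R.
Proof. by move=> a m m'; apply/ffunP => p; rewrite !ffunE scalerDr. Qed.
Fact asum_lactDl m : {morph asum_lact^~ m : a b / a + b}.
Proof. by move=> a b; apply/ffunP => p; rewrite !ffunE scalerDl. Qed.
HB.instance Definition _ := GRing.Zmodule_isLmodule.Build (gpa_base A) arrow_sum
  asum_lactA asum_lact1 asum_lactDr asum_lactDl.

Fact asum_ract1 m : asum_ract m 1 = m.
Proof. by apply/ffunP => p; rewrite [LHS]ffunE base1 ract1. Qed.
Fact asum_ractA m a b : asum_ract (asum_ract m a) b = asum_ract m (a * b).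
Proof.
by apply/ffunP => p; rewrite [LHS]ffunE [in LHS]ffunE [RHS]ffunE baseM ractA.
Qed.
Fact asum_ractDl m m' a :
  asum_ract (m + m') a = asum_ract m a + asum_ract m' a.
Proof.
apply/ffunP => p; rewrite [LHS]ffunE [in LHS]ffunE [RHS]ffunE.
by rewrite [X in _ = X + _]ffunE [X in _ = _ + X]ffunE ractDl.
Qed.
Fact asum_ractDr m a b : asum_ract m (a + b) = asum_ract m a + asum_ract m b.
Proof.
apply/ffunP => p; rewrite [LHS]ffunE baseD [RHS]ffunE.
by rewrite [X in _ = X + _]ffunE [X in _ = _ + X]ffunE ractDr.
Qed.
Fact asum_ractZ a m b : asum_ract (a *: m) b = a *: asum_ract m b.
Proof.
apply/ffunP => p; rewrite [LHS]ffunE [in LHS]ffunE [RHS]ffunE.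
by rewrite [in RHS]ffunE ractZ.
Qed.
Definition gpa_bimod : bimodule (gpa_base A) (gpa_base A) :=
  Bimodule asum_ract1 asum_ractA asum_ractDl asum_ractDr asum_ractZ.

Lemma gpa_bimod_central c (m : gpa_bimod) :
  base_scalar A c *: m = ract m (base_scalar A c).
Proof.
apply/ffunP => p; rewrite [LHS]ffunE [RHS]ffunE !base_scalarE.
exact: freebi_central.
Qed.

Definition gpa := talg gpa_bimod.
HB.instance Definition _ := GRing.PzRing.on gpa.

Definition gpa_scale (c : k) (x : gpa) : gpa :=
  (base_scalar A c *: (x : talg gpa_bimod)).
Fact gpa_scaleA c d x : gpa_scale c (gpa_scale d x) = gpa_scale (c * d) x.
Proof.
rewrite /gpa_scale scalerA; congr (_ *: _); apply/ffunP => i.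
by rewrite baseM !base_scalarE -scalerAl mul1r scalerA.
Qed.
Fact gpa_scale1 : left_id 1 gpa_scale.
Proof.
move=> x; rewrite /gpa_scale -[RHS]scale1r; congr (_ *: _); apply/ffunP => i.
by rewrite base1 base_scalarE scale1r.
Qed.
Fact gpa_scaleDr : right_distributive gpa_scale +%R.
Proof. by move=> c x y; apply: scalerDr. Qed.
Fact gpa_scaleDl x : {morph gpa_scale^~ x : c d / c + d}.
Proof.
move=> c d; rewrite /gpa_scale -[RHS]scalerDl; congr (_ *: _); apply/ffunP => i.
by rewrite baseD !base_scalarE scalerDl.
Qed.
HB.instance Definition _ := GRing.Zmodule_isLmodule.Build k gpa
  gpa_scaleA gpa_scale1 gpa_scaleDr gpa_scaleDl.

Lemma gpa_scalerAl (c : k) (x y : gpa) : c *: (x * y) = (c *: x) * y.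
Proof. exact/esym/tmul_scale. Qed.

Lemma gpa_scalerAr (c : k) (x y : gpa) : c *: (x * y) = x * (c *: y).
Proof.
pose T := talg gpa_bimod; pose b := base_scalar A c.
have key (z : T) n (t : tpow gpa_bimod n) : tmulc (b *: z) t = b *: tmulc z t.
  elim: n t => [a|n IH].
    by rewrite -[LHS]/((a : gpa_base A) *: (b *: z)) scalerA base_scalarC -scalerA.
  apply: tens_ext => [t u|t u|m t].
  - exact: (@tmulcB _ _ _ n.+1).
  - by rewrite (@tmulcB _ _ _ n.+1) scalerBr.
  - by rewrite !tmulcS IH tinsZ gpa_bimod_central tinsA.
rewrite -[LHS]/(b *: tmul (x : T) (y : T)) -[RHS]/(tmul (x : T) (b *: (y : T))).
rewrite /tmul scaler_sumr; apply: eq_bigr => n _.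
exact/esym/key.
Qed.
End GPA.

Definition gpa_iso (k : fieldType) (Q P : quiver)
    (A : qvert Q -> falgType k) (B : qvert P -> falgType k) :=
  exists f : gpa A -> gpa B, [/\ linear f, monoid_morphism f & bijective f].

Definition normal_gpa (k : fieldType) (Q : quiver) (A : qvert Q -> falgType k) :=
  forall i, simple_alg (A i).

Record premodulation (k : fieldType) := Premodulation {
  pm_vert : finType;
  pm_alg : pm_vert -> falgType k;
  pm_bimod : forall i j, bimodule (pm_alg i) (pm_alg j);
  pm_central : forall i j c (m : pm_bimod i j), c%:A *: m = ract m c%:A;
  pm_fgl : forall i j, fg_left (pm_bimod i j);
  pm_fgr : forall i j, fg_right (pm_bimod i j)
}.

Arguments pm_alg {k} p i.
Arguments pm_bimod {k} p i j.
Arguments pm_fgl {k} p i j.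
Arguments pm_fgr {k} p i j.

(* vq_val i j is the valuation (d_ij, d_ji) carried by the edge i -> j. When
   both i -> j and j -> i are edges, each one carries its own pair. *)
Record valued_quiver := ValuedQuiver {
  vq_vert : finType;
  vq_edge : vq_vert -> vq_vert -> Prop;
  vq_val : vq_vert -> vq_vert -> nat * nat
}.

Definition induced_vq (k : fieldType) (X : premodulation k) : valued_quiver :=
  @ValuedQuiver (pm_vert X)
    (fun i j => exists m : pm_bimod X i j, m <> 0)
    (fun i j => (rank_right (pm_fgr X i j), rank_left (pm_fgl X i j))).

Definition is_vq_iso (X Y : valued_quiver) (theta : vq_vert X -> vq_vert Y) :=
  [/\ bijective theta,
      forall i j, vq_edge i j <-> vq_edge (theta i) (theta j) &
      forall i j, vq_val i j = vq_val (theta i) (theta j)].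

Definition is_bimod_iso (R S R' S' : pzRingType) (phi : R -> R') (psi : S -> S')
    (M : bimodule R S) (N : bimodule R' S') (f : M -> N) :=
  [/\ bijective f,
      {morph f : m m' / m + m'},
      forall r m, f (r *: m) = phi r *: f m &
      forall m s, f (ract m s) = ract (f m) (psi s)].

Definition premod_iso (k : fieldType) (X Y : premodulation k) :=
  exists theta : pm_vert X -> pm_vert Y,
    @is_vq_iso (induced_vq X) (induced_vq Y) theta /\
    exists phi : forall i, {lrmorphism pm_alg X i -> pm_alg Y (theta i)},
      (forall i, bijective (phi i)) /\
      forall i j, exists f : pm_bimod X i j -> pm_bimod Y (theta i) (theta j),
        is_bimod_iso (phi i) (phi j) f.

Definition gpa_premod (k : fieldType) (Q : quiver) (A : qvert Q -> falgType k) :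
    premodulation k :=
  @Premodulation k (qvert Q) A (arrow_bimod A)
    (fun i j c m => freebi_central c m)
    (fun i j => freebi_fgl (A i) (A j) (arrows i j))
    (fun i j => freebi_fgr (A i) (A j) (arrows i j)).

(* Main.v *)
(* Constants A0 and arrows M generate T = k(Q, A), and an element of T whose
   degree 0 part vanishes is not a nonzero idempotent. Hence, if f : T -> T' is
   an isomorphism onto k(P, B), the map phi sending a constant a to the degree 0
   part of f(a) is injective: its kernel is a product of some of the simple
   algebras A_i, and the unit of A_i is idempotent. Applying this to f^-1 too,
   phi is an isomorphism A0 -> B0 for dimension reasons, and being an
   isomorphism of products of simple algebras it permutes the factors.
   An isomorphism need not preserve degrees, but setting r(x) = phi^-1(f(x)_0),
   the map x |-> (f(x) - f(r(x)))_1 is a derivation T -> N which vanishes on A0;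
   its restriction M -> N is therefore phi-semilinear and has the same image as
   the derivation, which is all of N. By finite dimension (and the analogous
   surjection N -> M) it is bijective, and it matches the blocks of M and N.
   The converse is the functoriality of the tensor algebra. *)
Require Import Defs.
From mathcomp Require Import all_boot all_order all_algebra all_field.
From HB Require Import structures.
From mathcomp Require Import boolp.

Set Implicit Arguments.
Unset Strict Implicit.
Unset Printing Implicit Defensive.

Import GRing.Theory.
Local Open Scope ring_scope.

(** * Finite-dimensional spaces *)

Section FiniteSpan.
Variables (k : fieldType) (V : lmodType k).

(** Encodes finite dimension for a bare [lmodType k], the form in which [gpa_base] and [arrow_space]
    are given. *)
Definition spanning (I : finType) (g : I -> V) :=
  forall v, exists c : I -> k, v = \sum_i c i *: g i.

(** A spanning family of least size is free, since a nontrivial relation would let one vector be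
    dropped. *)
Lemma spanning_free_basis (I : finType) (g : I -> V) : spanning g ->
  exists n (b : 'I_n -> V), spanning b /\
    forall c : 'I_n -> k, \sum_i c i *: b i = 0 -> forall i, c i = 0.
Proof.
move=> gP.
have ex : exists n, `[< exists b : 'I_n -> V, spanning b >].
  exists #|I|; apply/asboolP; exists (g \o enum_val) => v.
  have [c ->] := gP v; exists (c \o enum_val).
  by rewrite (reindex (@enum_val I predT)) //=; apply/onW_bij/enum_val_bij.
case: (ex_minnP ex) => n /asboolP[b bP] nmin; exists n, b; split=> // c c0 i.
apply/eqP/negPn/negP => ci.
case: n => [|n] in b bP nmin c c0 i ci *; first by case: i ci.
suff /nmin : `[< exists b : 'I_n -> V, spanning b >] by rewrite ltnn.
(* The relation expresses [b i] through the other vectors, which therefore still span. *)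
apply/asboolP; exists (b \o lift i) => v; have [d ->] := bP v.
move: c0; rewrite !(bigD1_ord i) //= => /(canRL (addrK _)); rewrite sub0r => c0.
have -> : b i = - ((c i)^-1 *: \sum_(j < n) c (lift i j) *: b (lift i j)).
  by rewrite -scalerN -c0 scalerA mulVf // scale1r.
exists (fun j => d (lift i j) - d i * (c i)^-1 * c (lift i j)).
rewrite scalerN scalerA addrC scaler_sumr -sumrB; apply: eq_bigr => j _.
by rewrite scalerA scalerBl.
Qed.

(** In coordinates [u] is right multiplication of row vectors by a square matrix [U], and each side
    amounts to [U] being invertible. *)
Lemma spanning_inj_surj (I : finType) (g : I -> V) (u : V -> V) :
  spanning g -> linear u -> injective u <-> (forall w, exists v, w = u v).
Proof.
move=> /spanning_free_basis[n [b [bP bfree]]] ulin.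
pose s (c : 'rV[k]_n) := \sum_i c 0 i *: b i.
have sP v : exists c, v = s c.
  have [c ->] := bP v; exists (\row_i c i).
  by apply: eq_bigr => i _; rewrite mxE.
have s0 c : s c = 0 -> c = 0.
  by move=> c0; apply/rowP => i; rewrite mxE; apply: (bfree (fun i => c 0 i)).
pose U := \matrix_i sval (cid (sP (u (b i)))).
have UE i : u (b i) = s (row i U).
  by rewrite rowK; apply: (svalP (cid (sP (u (b i))))).
pose uL : {linear V -> V} := HB.pack u (GRing.isLinear.Build k V V _ u ulin).
have us c : u (s c) = s (c *m U).
  rewrite -[u]/(uL : V -> V) linear_sum /s.
  under [RHS]eq_bigr do rewrite mxE scaler_suml.
  rewrite exchange_big; apply: eq_bigr => i _; rewrite linearZ /= UE scaler_sumr.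
  by apply: eq_bigr => j _; rewrite mxE scalerA.
split=> [uinj w|usurj].
  have Uu : U \in unitmx.
    rewrite -row_free_unit; apply: inj_row_free => c cU; apply/s0/uinj.
    rewrite us cU -[RHS]/(uL 0) linear0 /s.
    by rewrite big1 // => i _; rewrite mxE scale0r.
  have [d ->] := sP w; exists (s (d *m invmx U)).
  by rewrite us mulmxKV.
have s_inj c d : s c = s d -> c = d.
  move=> cd; apply/eqP; rewrite -subr_eq0; apply/eqP/s0.
  rewrite /s; under eq_bigr do rewrite !mxE scalerBl.
  by rewrite sumrB -/(s c) -/(s d) cd subrr.
have Uu : U \in unitmx.
  (* Coordinates of preimages of the [b i] form the rows of a left inverse of [U]. *)
  have CP i : exists c, b i = s (c *m U).
    have [v ->] := usurj (b i); have [c ->] := sP v; exists c; exact: us.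
  pose C := \matrix_i sval (cid (CP i)).
  suff /mulmx1_unit[] : C *m U = 1%:M by [].
  apply/row_matrixP => i; apply: s_inj.
  rewrite row_mul rowK -(svalP (cid (CP i))) /s (bigD1 i) //= !mxE eqxx scale1r.
  by rewrite big1 ?addr0 // => j ji; rewrite !mxE eq_sym (negPf ji) scale0r.
move=> v w; have [c ->] := sP v; have [d ->] := sP w; rewrite !us => /s_inj cd.
by rewrite -(mulmxK Uu c) cd mulmxK.
Qed.
End FiniteSpan.

(** [u \o v] is an injective endomorphism of a finite-dimensional space, hence surjective, and so is
    [u]. *)
Lemma inj_inj_bij (k : fieldType) (V W : lmodType k) (I : finType) (h : I -> W)
    (u : V -> W) (v : W -> V) : spanning h -> linear u -> linear v ->
  injective u -> injective v -> bijective u.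
Proof.
move=> hP ulin vlin uinj vinj.
have uvlin : linear (u \o v) by move=> c x y /=; rewrite vlin ulin.
have /(spanning_inj_surj hP uvlin) uvsurj := inj_comp uinj vinj.
have usurj w : exists x, u x = w by have [y ->] := uvsurj w; exists (v y).
pose u' w := sval (cid (usurj w)); have u'K w : u (u' w) = w := svalP (cid (usurj w)).
by exists u' => // x; apply: uinj; rewrite u'K.
Qed.

(** [v \o u] is a surjective endomorphism of a finite-dimensional space, hence injective, and so is
    [u]. *)
Lemma surj_surj_bij (k : fieldType) (V W : lmodType k) (I : finType) (h : I -> V)
    (u : V -> W) (v : W -> V) : spanning h -> linear u -> linear v ->
    (forall w, exists x, w = u x) -> (forall x, exists w, x = v w) ->
  bijective u.
Proof.
move=> hP ulin vlin usurj vsurj.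
have vulin : linear (v \o u) by move=> c x y /=; rewrite ulin vlin.
have /(spanning_inj_surj hP vulin) vuinj x : exists y, x = (v \o u) y.
  by have [w ->] := vsurj x; have [y ->] := usurj w; exists y.
pose u' w := sval (cid (usurj w)); have u'K w : u (u' w) = w.
  exact/esym/(svalP (cid (usurj w))).
by exists u' => // x; apply: vuinj; rewrite /= u'K.
Qed.

(** * Tensor algebras *)

Section RightAction.
Variables (R S : pzRingType) (M : bimodule R S).
Implicit Type m : M.

Lemma ractB m n s : ract (m - n) s = ract m s - ract n s.
Proof. by apply: (addIr (ract n s)); rewrite -ractDl !subrK. Qed.
Lemma ract0l s : ract (0 : M) s = 0.
Proof. by apply: (addrI (ract 0 s)); rewrite -ractDl !addr0. Qed.
Lemma ract0r m : ract m 0 = 0.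
Proof. by apply: (addrI (ract m 0)); rewrite -ractDr !addr0. Qed.
End RightAction.

(** * Components of degree 0 and 1 in a tensor algebra *)

Section TensorAlgebraGrading.
Variables (R : pzRingType) (M : bimodule R R).
Local Notation T := (talg M).
Implicit Types (x y : T) (a : R) (m : M).

Definition tconst a : T := a *: (1 : T).
Definition tvec m : T := tins m 1.
Definition deg0 x : R := x 0%N.
(** The component of degree 1 lives in [tens M R^o]; the canonical isomorphism with [M], given by
    the right action, brings it back. *)
Definition deg1 x : M := tlift (fun m (a : R^o) => ract m (a : R)) (x 1%N).

Lemma tconstM a x : tconst a * x = a *: x.
Proof. by rewrite -[LHS]/(tmul _ _) tmul_scale tmul1l. Qed.
Lemma tvecM m x : tvec m * x = tins m x.
Proof. by rewrite -[LHS]/(tmul _ _) tmul_ins tmul1l. Qed.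

(** Homogeneous elements are built from constants by prefixing vectors and taking differences, and
    every element is a finite sum of these. *)
Lemma talg_ind (P : T -> Prop) :
    (forall x y, P x -> P y -> P (x - y)) -> (forall a, P (tconst a)) ->
    (forall m x, P x -> P (tvec m * x)) -> forall x, P x.
Proof.
move=> PB Pc PM; have P0 : P 0 by rewrite -[0](scale0r (1 : T)); apply: Pc.
have PD x y : P x -> P y -> P (x + y).
  by move=> Px Py; rewrite -[y]opprK -[- y]sub0r; apply/PB/PB.
(* Multiplying by 1 on the right exposes [x] as the finite sum of its homogeneous components,
   embedded by [tmulc 1]. *)
move=> x; rewrite -[x]tmul1r; apply: (big_ind P) => // n _.
elim: (nat_of_ord n) (x n) => [a|{}n IH]; first exact: Pc.
elim/tens_ind => [|t u Pt Pu|m t].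
- by rewrite (@tmulc0 _ M _ n.+1).
- by rewrite (@tmulcB _ M _ n.+1); apply: PB.
- by rewrite tmulcS -tvecM; apply: PM.
Qed.

Lemma deg0B x y : deg0 (x - y) = deg0 x - deg0 y. Proof. by []. Qed.
Lemma deg0_const a : deg0 (tconst a) = a.
Proof. exact: (@mulr1 R a). Qed.
Lemma deg0_vec m : deg0 (tvec m) = 0. Proof. by []. Qed.

Lemma deg1_bal : balanced (fun m (a : R^o) => ract m (a : R)).
Proof.
split=> [m m' a|m a b|m a b]; [exact: ractDl | exact: ractDr | exact: ractA].
Qed.
Lemma deg1B x y : deg1 (x - y) = deg1 x - deg1 y.
Proof. exact: (tliftB deg1_bal). Qed.
Lemma deg1_0 : deg1 0 = 0.
Proof. by rewrite -[X in deg1 X](subrr 0) deg1B subrr. Qed.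
Lemma deg1Z a x : deg1 (a *: x) = a *: deg1 x.
Proof.
rewrite /deg1 -[(a *: x) 1%N]/(a *: x 1%N); move: (x 1%N).
apply: tens_ext => [t u|t u|m b].
- by rewrite scalerBr (tliftB deg1_bal).
- by rewrite (tliftB deg1_bal) scalerBr.
- by rewrite scale_tpure !(tlift_pure deg1_bal) ractZ.
Qed.
Lemma deg1_const a : deg1 (tconst a) = 0.
Proof.
rewrite deg1Z; apply: etrans (scaler0 M a); congr (_ *: _).
exact: deg1_0.
Qed.
Lemma deg1_ins m x : deg1 (tins m x) = ract m (deg0 x).
Proof. exact: (tlift_pure deg1_bal). Qed.
Lemma deg1_vec m : deg1 (tvec m) = m.
Proof. by rewrite deg1_ins ract1. Qed.

Lemma deg0M x y : deg0 (x * y) = deg0 x * deg0 y.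
Proof.
elim/talg_ind: x => [x x' IH IH'|a|m x _].
- by rewrite mulrBl !deg0B IH IH' mulrBl.
- by rewrite tconstM deg0_const.
- by rewrite -mulrA !tvecM [RHS]mul0r.
Qed.

(** Degree 1 of a product pairs degree 1 of one factor with degree 0 of the other, so [deg1] is a
    derivation along [deg0]. *)
Lemma deg1M x y :
  deg1 (x * y) = deg0 x *: deg1 y + ract (deg1 x) (deg0 y).
Proof.
elim/talg_ind: x => [x x' IH IH'|a|m x _].
- by rewrite mulrBl !deg1B IH IH' deg0B scalerBl ractB opprD addrACA.
- by rewrite tconstM deg1Z deg0_const deg1_const ract0l addr0.
- rewrite -mulrA !tvecM !deg1_ins deg0M -[deg0 (tins m x)]/(0 : R).
  by rewrite scale0r add0r ractA.
Qed.

(** Components of [x] of positive degree push [y] above degree [N], so only the degree 0 part of [x]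
    acts on the lowest term. *)
Lemma tmul_low N x y : (forall j, (j < N)%N -> y j = 0) ->
  (forall j, (j < N)%N -> (x * y) j = 0) /\ (x * y) N = deg0 x *: y N.
Proof.
move=> y0; elim/talg_ind: x => [x x' [IH IHN] [IH' IHN']|a|m x [IH _]].
- rewrite mulrBl; split=> [j jN|]; first by rewrite talgB IH ?IH' ?subrr.
  by rewrite talgB IHN IHN' deg0B scalerBl.
- rewrite tconstM deg0_const; split=> // j jN.
  by rewrite -[LHS]/(a *: y j) y0 ?scaler0.
- rewrite -mulrA !tvecM -[deg0 (tins m x)]/(0 : R) scale0r; split.
    by case=> [|j] // /ltnW jN; rewrite /= IH ?tpure0r.
  by case: N IH {y0} => //= N IH; rewrite IH ?tpure0r.
Qed.

(** If [x] vanishes below degree n, then its component in degree n equals that of [x * x], which is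
    [deg0 x *: x n], that is 0. *)
Lemma deg0_idem_eq0 x : x * x = x -> deg0 x = 0 -> x = 0.
Proof.
move=> xx x0; apply: talgP => n; elim/ltn_ind: n => n IH.
by rewrite -xx (proj2 (tmul_low x IH)) x0 scale0r.
Qed.

Lemma tconstD a b : tconst (a + b) = tconst a + tconst b.
Proof. exact: scalerDl. Qed.
Lemma tconstB a b : tconst (a - b) = tconst a - tconst b.
Proof. exact: scalerBl. Qed.
Lemma tconst_mul a b : tconst (a * b) = tconst a * tconst b.
Proof. by rewrite tconstM scalerA. Qed.
Lemma tvecB m n : tvec (m - n) = tvec m - tvec n.
Proof. by apply: (addIr (tvec n)); rewrite -tinsDl !subrK. Qed.
Lemma tvecZ a m : tvec (a *: m) = tconst a * tvec m.
Proof. by rewrite tconstM tinsZ. Qed.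
Lemma tvec_ract m a : tvec (ract m a) = tvec m * tconst a.
Proof. by rewrite tvecM -tinsA. Qed.
End TensorAlgebraGrading.

(** * Homomorphisms of tensor algebras that need not respect degrees *)

Section TensorAlgebraHom.
Variables (R S : pzRingType) (M : bimodule R R) (N : bimodule S S).
Variable f : talg M -> talg N.
Hypotheses (fB : {morph f : x y / x - y}) (fM : {morph f : x y / x * y}).

Definition base_part (a : R) : S := deg0 (f (tconst M a)).

Lemma base_partB : {morph base_part : a b / a - b}.
Proof. by move=> a b; rewrite /base_part tconstB fB deg0B. Qed.
Lemma base_partM : {morph base_part : a b / a * b}.
Proof. by move=> a b; rewrite /base_part tconst_mul fM deg0M. Qed.

Variable r : S -> R.
Hypotheses (rK : cancel r base_part) (Kr : cancel base_part r).

(* Subtracting the constant that f sends to the same degree 0 part makes tder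
   a derivation killing the constants, although f need not preserve degrees. *)
Definition tder (x : talg M) : N :=
  deg1 (f x) - deg1 (f (tconst M (r (deg0 (f x))))).
Definition vec_part (m : M) : N := tder (tvec m).

Lemma tderB x y : tder (x - y) = tder x - tder y.
Proof.
have rB a b : r (a - b) = r a - r b.
  by apply: (can_inj Kr); rewrite base_partB !rK.
by rewrite /tder fB deg0B rB tconstB fB !deg1B !opprD addrACA.
Qed.

(** Both terms of [tder] obey the rule [deg1M] with the same degree 0 coefficients, because [r]
    inverts [base_part]; hence so does their difference. *)
Lemma tderM x y :
  tder (x * y) = deg0 (f x) *: tder y + ract (tder x) (deg0 (f y)).
Proof.
have rM a b : r (a * b) = r a * r b.
  by apply: (can_inj Kr); rewrite base_partM !rK.
rewrite /tder fM deg0M rM tconst_mul fM !deg1M.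
rewrite -![deg0 (f (tconst _ (r _)))]/(base_part _) !rK.
by rewrite scalerBr ractB opprD addrACA.
Qed.

Lemma tder_const a : tder (tconst M a) = 0.
Proof. by rewrite /tder -[deg0 _]/(base_part a) Kr subrr. Qed.

Lemma vec_partZ a m : vec_part (a *: m) = base_part a *: vec_part m.
Proof. by rewrite /vec_part tvecZ tderM tder_const ract0l addr0. Qed.
Lemma vec_part_ract m a : vec_part (ract m a) = ract (vec_part m) (base_part a).
Proof. by rewrite /vec_part tvec_ract tderM tder_const scaler0 add0r. Qed.
Lemma vec_partB : {morph vec_part : m n / m - n}.
Proof. by move=> m n; rewrite /vec_part tvecB tderB. Qed.

(** Constants and vectors generate, and [tder] is a derivation killing constants, so its image is no
    larger than that of the vectors. *)
Lemma tder_vec_part x : exists m, tder x = vec_part m.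
Proof.
elim/talg_ind: x => [x y [m xm] [n yn]|a|m x [n xn]].
- by exists (m - n); rewrite tderB xm yn vec_partB.
- by exists 0; rewrite tder_const -[X in vec_part X](subrr 0) vec_partB subrr.
(* The two terms of the Leibniz rule, with coefficients pulled back along [r]. *)
exists (r (deg0 (f (tvec m))) *: n + ract m (r (deg0 (f x)))).
rewrite (morphB_D vec_partB) vec_partZ vec_part_ract !rK tderM xn.
by [].
Qed.

(** If [f x = tvec n], then [f x] has degree 0 part zero, so the correction in [tder] vanishes and
    [tder x = n]. *)
Lemma vec_part_surj : (forall y, exists x, y = f x) ->
  forall n, exists m, n = vec_part m.
Proof.
move=> fsurj n; have [x nx] := fsurj (tvec n); have [m xm] := tder_vec_part x.
exists m; rewrite -xm /tder -nx deg0_vec deg1_vec.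
have -> : r 0 = 0.
  by apply: (can_inj Kr); rewrite rK -[X in base_part X](subrr 0) base_partB subrr.
rewrite -[X in tconst M X](subrr 0) tconstB subrr.
by rewrite -[X in f X](subrr 0) fB subrr deg1_0 subr0.
Qed.
End TensorAlgebraHom.

(** * Functoriality of the tensor algebra *)

Section TensorAlgebraFunctor.
Variables (R S : pzRingType) (M : bimodule R R) (N : bimodule S S).
Variables (phi : R -> S) (psi : M -> N).
Hypotheses (phiB : {morph phi : a b / a - b}) (phiM : {morph phi : a b / a * b}).
Hypothesis phi1 : phi 1 = 1.
Hypothesis psiB : {morph psi : m n / m - n}.
Hypothesis psiZ : forall a m, psi (a *: m) = phi a *: psi m.
Hypothesis psi_ract : forall m a, psi (ract m a) = ract (psi m) (phi a).

Fixpoint tpow_map n : tpow M n -> tpow N n :=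
  if n is n'.+1 return tpow M n -> tpow N n
  then tlift (fun m t => tpure (psi m) (@tpow_map n' t)) else phi.

(** Additivity and semilinearity go through one induction: both in degree n are needed for the map
    in degree n + 1 to be balanced. *)
Lemma tpow_map_props n :
  {morph @tpow_map n : t u / t - u} /\
  forall a t, @tpow_map n (a *: t) = phi a *: tpow_map t.
Proof.
elim: n => [|n [IHB IHZ]]; first by split=> *; [apply: phiB | apply: phiM].
have bal : balanced (fun m t => tpure (psi m) (@tpow_map n t)).
  split=> [m m' t|m t u|m a t].
  - by rewrite (morphB_D psiB) tpureDl.
  - by rewrite (morphB_D IHB) tpureDr.
  - by rewrite psi_ract tpureA IHZ.
have B : {morph @tpow_map n.+1 : t u / t - u} by move=> t u; apply: tliftB.
split=> // a; apply: tens_ext => [t u|t u|m t].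
- by rewrite scalerBr B.
- by rewrite B scalerBr.
- by rewrite scale_tpure /= !tlift_pure // psiZ scale_tpure.
Qed.

Lemma tpow_mapB n : {morph @tpow_map n : t u / t - u}.
Proof. by case: (tpow_map_props n). Qed.
Lemma tpow_mapD n : {morph @tpow_map n : t u / t + u}.
Proof. exact/morphB_D/tpow_mapB. Qed.
Lemma tpow_map0 n : @tpow_map n 0 = 0.
Proof. by rewrite -[X in tpow_map X](subrr 0) tpow_mapB subrr. Qed.
Lemma tpow_mapZ n a t : @tpow_map n (a *: t) = phi a *: tpow_map t.
Proof. by case: (tpow_map_props n) => _ ->. Qed.
Lemma tpow_mapS n m t :
  @tpow_map n.+1 (tpure m t) = tpure (psi m) (tpow_map t).
Proof.
have bal : balanced (fun m t => tpure (psi m) (@tpow_map n t)).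
  split=> [m' m'' u|m' u u'|m' a u].
  - by rewrite (morphB_D psiB) tpureDl.
  - by rewrite tpow_mapD tpureDr.
  - by rewrite psi_ract tpureA tpow_mapZ.
exact: (tlift_pure bal).
Qed.

Fact talg_map_fin (x : talg M) :
  exists n0, forall n, (n0 <= n)%N -> tpow_map (x n) = 0.
Proof. by case: x => x [n0 x0]; exists n0 => n /x0 /= ->; apply: tpow_map0. Qed.
Definition talg_map (x : talg M) : talg N := TAlg (talg_map_fin x).

Lemma talg_mapB : {morph talg_map : x y / x - y}.
Proof. by move=> x y; apply: talgP => n; apply: tpow_mapB. Qed.
Lemma talg_mapZ a x : talg_map (a *: x) = phi a *: talg_map x.
Proof. by apply: talgP => n; apply: tpow_mapZ. Qed.
Lemma talg_map1 : talg_map 1 = 1.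
Proof. by apply: talgP => -[|n]; [apply: phi1 | apply: tpow_map0]. Qed.
Lemma talg_map_ins m x : talg_map (tins m x) = tins (psi m) (talg_map x).
Proof. by apply: talgP => -[|n]; [apply: (@tpow_map0 0) | apply: tpow_mapS]. Qed.
Lemma talg_mapM : {morph talg_map : x y / x * y}.
Proof.
move=> x y; elim/talg_ind: x => [x x' IH IH'|a|m x IH].
- by rewrite mulrBl !talg_mapB IH IH' mulrBl.
- by rewrite tconstM !talg_mapZ talg_map1 -/(tconst N (phi a)) tconstM.
- by rewrite -mulrA !tvecM !talg_map_ins IH -!tvecM mulrA.
Qed.
End TensorAlgebraFunctor.

Lemma tpow_mapK (R S : pzRingType) (M : bimodule R R) (N : bimodule S S)
    (phi : R -> S) (psi : M -> N) (phi' : S -> R) (psi' : N -> M) :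
    {morph phi : a b / a - b} -> {morph phi : a b / a * b} ->
    {morph phi' : a b / a - b} -> {morph phi' : a b / a * b} ->
    {morph psi : m n / m - n} -> {morph psi' : m n / m - n} ->
    forall (psiZ : forall a m, psi (a *: m) = phi a *: psi m)
      (psi_ract : forall m a, psi (ract m a) = ract (psi m) (phi a))
      (psi'Z : forall a m, psi' (a *: m) = phi' a *: psi' m)
      (psi'_ract : forall m a, psi' (ract m a) = ract (psi' m) (phi' a)),
    cancel phi phi' -> cancel psi psi' ->
  forall n, cancel (@tpow_map _ _ M N phi psi n) (@tpow_map _ _ N M phi' psi' n).
Proof.
move=> phiB phiM phi'B phi'M psiB psi'B psiZ psi_ract psi'Z psi'_ract phiK psiK.
elim=> [|n IH]; first exact: phiK.
apply: tens_ext => [t u|t u|m t].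
- by rewrite (@tpow_mapB _ _ _ _ _ _ phiB phiM psiB psiZ psi_ract n.+1)
    (@tpow_mapB _ _ _ _ _ _ phi'B phi'M psi'B psi'Z psi'_ract n.+1).
- by [].
- by rewrite !tpow_mapS // psiK IH.
Qed.

(** The inverses of [phi] and [psi] are again compatible with all operations, so they induce a map
    backwards, inverse in each degree. *)
Lemma talg_map_bij (R S : pzRingType) (M : bimodule R R) (N : bimodule S S)
    (phi : R -> S) (psi : M -> N)
    (phiB : {morph phi : a b / a - b}) (phiM : {morph phi : a b / a * b})
    (psiB : {morph psi : m n / m - n})
    (psiZ : forall a m, psi (a *: m) = phi a *: psi m)
    (psi_ract : forall m a, psi (ract m a) = ract (psi m) (phi a)) :
  bijective phi -> bijective psi ->
  bijective (talg_map phiB phiM psiB psiZ psi_ract).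
Proof.
case=> phi' phiK phi'K [psi' psiK psi'K].
have phi'B : {morph phi' : a b / a - b}.
  by move=> a b; apply: (can_inj phiK); rewrite phiB !phi'K.
have phi'M : {morph phi' : a b / a * b}.
  by move=> a b; apply: (can_inj phiK); rewrite phiM !phi'K.
have psi'B : {morph psi' : m n / m - n}.
  by move=> m n; apply: (can_inj psiK); rewrite psiB !psi'K.
have psi'Z a m : psi' (a *: m) = phi' a *: psi' m.
  by apply: (can_inj psiK); rewrite psiZ !psi'K phi'K.
have psi'_ract m a : psi' (ract m a) = ract (psi' m) (phi' a).
  by apply: (can_inj psiK); rewrite psi_ract !psi'K phi'K.
exists (talg_map phi'B phi'M psi'B psi'Z psi'_ract) => x; apply: talgP => n.
  exact: tpow_mapK.
exact: tpow_mapK.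
Qed.

(** * Blocks of the base algebra and of the arrow bimodule *)

Section BaseBlocks.
Variables (k : fieldType) (V : finType) (A : V -> falgType k).
Local Notation A0 := (gpa_base A).

Fact base_scaleA c d (x : A0) :
  base_scalar A c * (base_scalar A d * x) = base_scalar A (c * d) * x.
Proof.
rewrite mulrA; congr (_ * _); apply/ffunP => i.
by rewrite baseM !base_scalarE -scalerAl mul1r scalerA.
Qed.
Fact base_scale1 (x : A0) : base_scalar A 1 * x = x.
Proof. by apply/ffunP => i; rewrite baseM base_scalarE scale1r mul1r. Qed.
Fact base_scaleDr c (x y : A0) :
  base_scalar A c * (x + y) = base_scalar A c * x + base_scalar A c * y.
Proof. exact: mulrDr. Qed.
Lemma base_scalarD c d : base_scalar A (c + d) = base_scalar A c + base_scalar A d.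
Proof. by apply/ffunP => i; rewrite baseD !base_scalarE scalerDl. Qed.
Fact base_scaleDl (x : A0) c d :
  base_scalar A (c + d) * x = base_scalar A c * x + base_scalar A d * x.
Proof. by rewrite base_scalarD mulrDl. Qed.
HB.instance Definition _ := GRing.Zmodule_isLmodule.Build k A0
  base_scaleA base_scale1 base_scaleDr base_scaleDl.

Lemma base_scaleE c (x : A0) : c *: x = base_scalar A c * x.
Proof. by []. Qed.
Lemma baseZ c (x : A0) i : (c *: x) i = c *: x i.
Proof. by rewrite base_scaleE baseM base_scalarE mulr_algl. Qed.
Lemma base0 i : (0 : A0) i = 0. Proof. exact: ffunE. Qed.
Lemma baseB (x y : A0) i : (x - y) i = x i - y i.
Proof. by apply: (addIr (y i)); rewrite -baseD !subrK. Qed.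
Lemma base_sum (I : finType) (F : I -> A0) i : (\sum_j F j) i = \sum_j F j i.
Proof.
by apply: (big_morph (fun x : A0 => x i)) => [x y|]; [apply: baseD | apply: base0].
Qed.

(** Inclusion of the factor [A i]; [bdelta 1] is the central idempotent e_i that cuts it out. *)
Definition bdelta i (x : A i) : A0 := finfun (dfwith (fun j => 0 : A j) x).

Lemma bdelta_in i (x : A i) : bdelta x i = x.
Proof. by rewrite ffunE dfwith_in. Qed.
Lemma bdelta_out i (x : A i) j : i != j -> bdelta x j = 0.
Proof. by move=> ij; rewrite ffunE dfwith_out. Qed.

(** Reduces an identity between elements supported at [i] to its component at [i]. *)
Lemma base_supportP (a : A0) i :
  (forall j, i != j -> a j = 0) -> a = bdelta (a i).
Proof.
move=> a0; apply/ffunP => j; have [<-|ij] := eqVneq i j.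
  by rewrite bdelta_in.
by rewrite a0 ?bdelta_out.
Qed.

Lemma bdeltaB i : {morph @bdelta i : x y / x - y}.
Proof.
move=> x y; rewrite [RHS](@base_supportP _ i) ?baseB ?bdelta_in // => j ij.
by rewrite baseB !bdelta_out ?subrr.
Qed.
Lemma bdeltaM i : {morph @bdelta i : x y / x * y}.
Proof.
move=> x y; rewrite [RHS](@base_supportP _ i) ?baseM ?bdelta_in // => j ij.
by rewrite baseM !bdelta_out ?mulr0.
Qed.
Lemma bdeltaZ i c (x : A i) : bdelta (c *: x) = c *: bdelta x.
Proof.
rewrite [RHS](@base_supportP _ i) ?baseZ ?bdelta_in // => j ij.
by rewrite baseZ !bdelta_out ?scaler0.
Qed.
Lemma mul_bdelta1 i (a : A0) : bdelta (1 : A i) * a = bdelta (a i).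
Proof.
rewrite [LHS](@base_supportP _ i) ?baseM ?bdelta_in ?mul1r // => j ij.
by rewrite baseM !bdelta_out ?mul0r.
Qed.
Lemma bdelta1_comm i (a : A0) : bdelta (1 : A i) * a = a * bdelta (1 : A i).
Proof.
rewrite mul_bdelta1 [RHS](@base_supportP _ i) ?baseM ?bdelta_in ?mulr1 // => j ij.
by rewrite baseM !bdelta_out ?mulr0.
Qed.
Lemma bdelta_neq0 i (x : A i) : x != 0 -> bdelta x != 0.
Proof. by apply: contra => /eqP x0; rewrite -[x]bdelta_in x0 base0. Qed.
Lemma bdelta1_inj i j : bdelta (1 : A i) = bdelta (1 : A j) -> i = j.
Proof.
move=> e; apply/eqP; apply: contraTT (oner_neq0 (A i)) => ij.
by rewrite negbK -[1]bdelta_in e bdelta_out // eq_sym.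
Qed.
Lemma base_sum_bdelta (a : A0) : a = \sum_i bdelta (a i).
Proof.
apply/ffunP => i; rewrite base_sum (bigD1 i) //= bdelta_in big1 ?addr0 // => j ji.
exact: bdelta_out.
Qed.
End BaseBlocks.

Lemma spanning_sum (k : fieldType) (W : lmodType k) (I : finType) (J : I -> finType)
    (g : forall i, J i -> W) :
    (forall w, exists c : forall i, J i -> k, w = \sum_i \sum_j c i j *: g i j) ->
  spanning (fun p : {i : I & J i} => g (tag p) (tagged p)).
Proof.
move=> gP w; have [c ->] := gP w; exists (fun p => c (tag p) (tagged p)).
exact: (sig_big_dep _ _ (fun i j => c i j *: g i j)).
Qed.

Lemma base_spanning (k : fieldType) (V : finType) (A : V -> falgType k) :
  exists (I : finType) (g : I -> gpa_base A), spanning g.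
Proof.
refine (ex_intro _ _ (ex_intro _ _ (@spanning_sum _ (gpa_base A) _
  (fun i => 'I_(\dim {:A i})) (fun i j => bdelta ((vbasis {:A i})`_j)) _))) => a.
exists (fun i j => coord (vbasis {:A i}) j (a i)).
rewrite [LHS]base_sum_bdelta; apply: eq_bigr => i _.
rewrite {1}(coord_vbasis (memvf (a i))).
have D := morphB_D (@bdeltaB _ _ A i).
have d0 : bdelta (0 : A i) = 0.
  by apply: (addrI (bdelta (0 : A i))); rewrite -D !addr0.
rewrite (big_morph _ D d0); apply: eq_bigr => j _; exact: bdeltaZ.
Qed.

Section ArrowBlocks.
Variables (k : fieldType) (Q : quiver) (A : qvert Q -> falgType k).
Local Notation M := (gpa_bimod A).
Local Notation arr p := (arrow_bimod A p.1 p.2).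
Implicit Type m : arrow_sum A.

(* arrow_sum A already carries its module structure over gpa_base A, so the
   underlying k-space lives on an alias. *)
Definition arrow_space := arrow_sum A.
HB.instance Definition _ := GRing.Zmodule.on arrow_space.
Definition arrow_scale (c : k) (m : arrow_space) : arrow_space :=
  base_scalar A c *: (m : M).
Fact arrow_scaleA c d m : arrow_scale c (arrow_scale d m) = arrow_scale (c * d) m.
Proof.
rewrite /arrow_scale scalerA; congr (_ *: _); apply/ffunP => i.
by rewrite baseM !base_scalarE -scalerAl mul1r scalerA.
Qed.
Fact arrow_scale1 : left_id 1 arrow_scale.
Proof.
move=> m; rewrite -[RHS](@scale1r _ M); congr (_ *: _); apply/ffunP => i.
by rewrite base1 base_scalarE scale1r.
Qed.
Fact arrow_scaleDr : right_distributive arrow_scale +%R.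
Proof. by move=> c m n; apply: (@scalerDr _ M). Qed.
Fact arrow_scaleDl (m : arrow_space) : {morph arrow_scale^~ m : c d / c + d}.
Proof. by move=> c d; rewrite /arrow_scale base_scalarD; apply: (@scalerDl _ M). Qed.
HB.instance Definition _ := GRing.Zmodule_isLmodule.Build k arrow_space
  arrow_scaleA arrow_scale1 arrow_scaleDr arrow_scaleDl.

Lemma asumZ (a : gpa_base A) (m : M) p : (a *: m) p = a p.1 *: m p.
Proof. exact: ffunE. Qed.
Lemma asum_ractE (m : M) (a : gpa_base A) p : ract m a p = ract (m p) (a p.2).
Proof. exact: ffunE. Qed.
Lemma asumD m m' p : (m + m') p = m p + m' p. Proof. exact: ffunE. Qed.
Lemma asum0 p : (0 : arrow_sum A) p = 0. Proof. exact: ffunE. Qed.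
Lemma asumB m m' p : (m - m') p = m p - m' p.
Proof. by apply: (addIr (m' p)); rewrite -asumD !subrK. Qed.
Lemma asum_sum (I : finType) (F : I -> arrow_sum A) p :
  (\sum_j F j) p = \sum_j F j p.
Proof.
by apply: (big_morph (fun m => m p)) => [x y|]; [apply: asumD | apply: asum0].
Qed.

Definition adelta p (x : arr p) : M :=
  finfun (dfwith (fun q => 0 : arr q) x).

Lemma adelta_in p (x : arr p) : adelta x p = x.
Proof. by rewrite ffunE dfwith_in. Qed.
Lemma adelta_out p (x : arr p) q : p != q -> adelta x q = 0.
Proof. by move=> pq; rewrite ffunE dfwith_out. Qed.
Lemma asum_supportP m p : (forall q, p != q -> m q = 0) -> m = adelta (m p).
Proof.
move=> m0; apply/ffunP => q; have [<-|pq] := eqVneq p q.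
  by rewrite adelta_in.
by rewrite (m0 q pq) (adelta_out _ pq).
Qed.
Lemma adeltaB p : {morph @adelta p : x y / x - y}.
Proof.
move=> x y; rewrite [RHS](@asum_supportP _ p) ?asumB ?adelta_in // => q pq.
by rewrite asumB !adelta_out ?subrr.
Qed.
Lemma adeltaZ p (a : A p.1) (x : arr p) :
  adelta (a *: x) = bdelta a *: adelta x.
Proof.
rewrite [RHS](@asum_supportP _ p) ?asumZ ?adelta_in ?bdelta_in // => q pq.
by rewrite asumZ !adelta_out ?scaler0.
Qed.
Lemma adelta_ract p (x : arr p) (a : A p.2) :
  adelta (ract x a) = ract (adelta x) (bdelta a).
Proof.
rewrite [RHS](@asum_supportP _ p) ?asum_ractE ?adelta_in ?bdelta_in // => q pq.
by rewrite asum_ractE !adelta_out ?ract0l.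
Qed.
(** Peirce decomposition: the block at [p] is recovered by multiplying with the idempotents of its
    two ends, which semilinear maps can follow. *)
Lemma block_adelta p (m : M) :
  bdelta (1 : A p.1) *: ract m (bdelta (1 : A p.2)) = adelta (m p).
Proof.
rewrite [LHS](@asum_supportP _ p).
  by rewrite asumZ asum_ractE !bdelta_in scale1r ract1.
move=> q; rewrite asumZ asum_ractE -pair_eqE negb_and => /orP[] ne.
  by rewrite (bdelta_out _ ne) scale0r.
by rewrite (bdelta_out _ ne) ract0r scaler0.
Qed.
Lemma asum_sum_adelta m : m = \sum_p adelta (m p).
Proof.
apply/ffunP => p; rewrite asum_sum (bigD1 p) //= adelta_in big1 ?addr0 // => q qp.
exact: adelta_out.
Qed.
Lemma adelta_scale p (c : k) (x : arr p) :
  adelta (c%:A *: x) = (c *: (adelta x : arrow_space) : arrow_space).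
Proof.
rewrite -[RHS]/(base_scalar A c *: adelta x).
rewrite [RHS](@asum_supportP _ p) ?asumZ ?adelta_in ?base_scalarE // => q pq.
by rewrite asumZ !adelta_out ?scaler0.
Qed.

(** In each block, multiplying finitely many left generators by a [k]-basis of the algebra acting on
    the left gives a spanning family. *)
Lemma arrow_spanning : exists (I : finType) (g : I -> arrow_space), spanning g.
Proof.
have fg p : exists n, exists g : 'I_n -> arr p, forall x,
    exists r : 'I_n -> A p.1, x = \sum_i r i *: g i.
  have [n /asboolP gn] := freebi_fgl (A p.1) (A p.2) (arrows p.1 p.2).
  by exists n.
pose n p := sval (cid (fg p)).
pose g p : 'I_(n p) -> arr p := sval (cid (svalP (cid (fg p)))).
have gP p x : exists r : 'I_(n p) -> A p.1, x = \sum_i r i *: g p i.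
  exact: (svalP (cid (svalP (cid (fg p)))) x).
refine (ex_intro _ _ (ex_intro _ _ (@spanning_sum k arrow_space _
  (fun p : qvert Q * qvert Q => ('I_(n p) * 'I_(\dim {:A p.1}))%type)
  (fun p q => adelta ((vbasis {:A p.1})`_q.2 *: g p q.1)) _))) => m.
pose r p := sval (cid (gP p (m p))).
have rP p : m p = \sum_i r p i *: g p i := svalP (cid (gP p (m p))).
exists (fun p q => coord (vbasis {:A p.1}) q.2 (r p q.1)).
rewrite [LHS]asum_sum_adelta; apply: eq_bigr => p _; rewrite rP.
have D := morphB_D (@adeltaB p).
have d0 : adelta (0 : arr p) = 0.
  by apply: (addrI (adelta (0 : arr p))); rewrite -D !addr0.
rewrite (big_morph _ D d0).
rewrite -(pair_bigA _ (fun i j => coord (vbasis {:A p.1}) j (r p i) *: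
  (adelta ((vbasis {:A p.1})`_j *: g p i) : arrow_space))) /=.
apply: eq_bigr => i _; rewrite {1}(coord_vbasis (memvf (r p i))).
rewrite scaler_suml (big_morph _ D d0); apply: eq_bigr => j _.
by rewrite -adelta_scale scalerA mulr_algl.
Qed.
End ArrowBlocks.

(** * Isomorphisms of products of simple algebras *)

Lemma linear_sub (k : pzRingType) (V W : lmodType k) (f : V -> W) :
  linear f -> {morph f : x y / x - y}.
Proof. by move=> flin x y; rewrite -scaleN1r addrC flin scaleN1r addrC. Qed.

Lemma linear_scale (k : pzRingType) (V W : lmodType k) (f : V -> W) c x :
  linear f -> f (c *: x) = c *: f x.
Proof.
move=> flin; have f0 : f 0 = 0 by rewrite -[X in f X](subrr 0) linear_sub ?subrr.
by rewrite -[c *: x]addr0 flin f0 addr0.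
Qed.

(** The kernel of multiplication by [1 - z] is a two-sided ideal containing [z]: if it is zero then
    z = 0, and if it contains 1 then z = 1. *)
Lemma simple_alg_central_idem (k : fieldType) (A : falgType k) (z : A) :
  simple_alg A -> (forall x, x * z = z * x) -> z * z = z -> z = 0 \/ z = 1.
Proof.
move=> simA zC zz; have inI x : (x \in lker (amull (1 - z))) = ((1 - z) * x == 0).
  by rewrite memv_ker lfunE.
have [a x|I0|IT] := simA (lker (amull (1 - z))).
- rewrite !inI => /eqP x0; split; last by rewrite mulrA x0 mul0r.
  by rewrite mulrA mulrBl mul1r -zC -[X in X - _]mulr1 -mulrBr -mulrA x0 mulr0.
- by left; apply/eqP; rewrite -memv0 -I0 inI mulrBl mul1r zz subrr.
- right; apply/esym/eqP; rewrite -subr_eq0 -[1 - z]mulr1 -inI IT.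
  exact: memvf.
Qed.

Section BaseIso.
Variables (k : fieldType) (V W : finType).
Variables (A : V -> falgType k) (B : W -> falgType k).

(** The elements of [A i] killed by [phi] form an ideal. A kernel element with nonzero component at
    [i] makes it nonzero, hence all of [A i], although the unit survives. *)
Lemma base_hom_inj (phi : gpa_base A -> gpa_base B) :
    (forall i, simple_alg (A i)) -> linear phi -> {morph phi : a b / a * b} ->
    (forall i, phi (bdelta (1 : A i)) != 0) -> injective phi.
Proof.
move=> simA philin phiM phi1 a b /eqP; rewrite -subr_eq0 -(linear_sub philin).
move=> /eqP ab0; apply/eqP; rewrite -subr_eq0; move: (a - b) ab0 => {a b} a a0.
apply/eqP/ffunP => i; rewrite [RHS]base0; apply/eqP/negPn/negP => ai0.
have lin j : linear (fun x : A i => phi (bdelta x) j).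
  move=> c x y /=; have := morphB_D (@bdeltaB _ _ A i) (c *: x) y => /= ->.
  by rewrite bdeltaZ philin baseD baseZ.
pose u j : {linear A i -> B j} :=
  HB.pack (fun x : A i => phi (bdelta x) j) (GRing.isLinear.Build k _ _ _ _ (lin j)).
(* Simplicity quantifies over subspaces, so the kernel is assembled from the kernels of the linear
   components. *)
pose I := (\bigcap_j lker (linfun (u j)))%VS.
have inI x : (x \in I) <-> phi (bdelta x) = 0.
  rewrite memvE; split=> [/subv_bigcapP xI|x0].
    apply/ffunP => j; rewrite [RHS]base0; apply/eqP.
    by have := xI j isT; rewrite -memvE memv_ker lfunE.
  apply/subv_bigcapP => j _; rewrite -memvE memv_ker lfunE /=.
  by rewrite x0 base0.
have [c x /inI x0|I0|IT] := simA i I.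
- split; apply/inI; rewrite bdeltaM phiM x0 ?mulr0 ?mul0r //.
- case/negP: ai0; rewrite -memv0 -I0; apply/inI.
  by rewrite -mul_bdelta1 phiM a0 mulr0.
- by case/eqP: (phi1 i); apply/inI; rewrite IT memvf.
Qed.

Variables (phi : gpa_base A -> gpa_base B) (phi' : gpa_base B -> gpa_base A).
Hypotheses (phiB : {morph phi : a b / a - b}) (phiM : {morph phi : a b / a * b}).
Hypotheses (phiK : cancel phi phi') (phi'K : cancel phi' phi).
Hypotheses (simA : forall i, simple_alg (A i)) (simB : forall j, simple_alg (B j)).

Let phi0 : phi 0 = 0. Proof. by rewrite -[X in phi X](subrr 0) phiB subrr. Qed.

(* A nonzero component at j of the image of the unit e_i is a central
   idempotent, hence 1, so the unit e_j comes from a central idempotent below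
   e_i, which can only be e_i. *)
Lemma base_iso_unit i : exists j, phi (bdelta (1 : A i)) = bdelta (1 : B j).
Proof.
have phi'M : {morph phi' : a b / a * b}.
  by move=> a b; apply: (can_inj phiK); rewrite phiM !phi'K.
have ei0 : phi (bdelta (1 : A i)) != 0.
  by rewrite -phi0 (can_eq phiK) bdelta_neq0 ?oner_neq0.
have [j ej0] : exists j, phi (bdelta (1 : A i)) j != 0.
  apply/existsP; apply: contraNT ei0 => /existsPn ei0.
  by apply/eqP/ffunP => j; rewrite [RHS]base0; apply/eqP/negbNE.
exists j.
have ej1 : phi (bdelta (1 : A i)) j = 1.
  case: (@simple_alg_central_idem _ _ (phi (bdelta (1 : A i)) j) (@simB j)) => //.
  (* Surjectivity of [phi] writes [y] as a component of an image, which reduces centrality to that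
     of e_i. *)
  - move=> y; rewrite -[y]bdelta_in -!baseM -[bdelta y]phi'K -!phiM.
    by rewrite bdelta1_comm.
  - by rewrite -baseM -phiM -bdeltaM mulr1.
  - by move=> e0; rewrite e0 eqxx in ej0.
pose z := phi' (bdelta (1 : B j)).
have zz : z * z = z by rewrite /z -phi'M -bdeltaM mulr1.
have zC a : a * z = z * a.
  by apply: (can_inj phiK); rewrite !phiM /z phi'K bdelta1_comm.
have zi : z = bdelta (z i).
  rewrite -mul_bdelta1; apply: (can_inj phiK); rewrite phiM /z phi'K.
  by rewrite -bdelta1_comm mul_bdelta1 ej1.
case: (@simple_alg_central_idem _ _ (z i) (@simA i)) => [x||z0|z1].
- by rewrite -[x]bdelta_in -!baseM zC.
- by rewrite -baseM zz.
- have : z != 0.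
    apply: contraNneq (oner_neq0 (B j)) => z0'.
    by rewrite -[1]bdelta_in -[bdelta 1]phi'K -/z z0' phi0 base0.
  by rewrite zi z0 -[0](subrr 0) bdeltaB subrr eqxx.
- by rewrite -z1 -zi phi'K.
Qed.
End BaseIso.

(** * Isomorphic pre-modulations *)

Section BimoduleIso.
Variables (R S R' S' : pzRingType) (phi : R -> R') (psi : S -> S').
Variables (M : bimodule R S) (N : bimodule R' S') (f : M -> N).
Hypothesis fiso : is_bimod_iso phi psi f.

Lemma bimod_iso0 : f 0 = 0.
Proof. by case: fiso => _ fD _ _; apply: (addrI (f 0)); rewrite -fD !addr0. Qed.

Lemma bimod_isoB : {morph f : m n / m - n}.
Proof.
by case: fiso => _ fD _ _ m n; apply: (addIr (f n)); rewrite -fD !subrK.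
Qed.

Lemma bimod_iso_inv (phi' : R' -> R) (psi' : S' -> S) :
    cancel phi' phi -> cancel psi' psi ->
  exists f' : N -> M, is_bimod_iso phi' psi' f'.
Proof.
case: fiso => [[f' fK f'K] fD fZ fR] phiK psiK; exists f'; split.
- by exists f.
- by move=> m n; apply: (can_inj fK); rewrite fD !f'K.
- by move=> r n; apply: (can_inj fK); rewrite fZ !f'K phiK.
- by move=> n s; apply: (can_inj fK); rewrite fR !f'K psiK.
Qed.

Lemma bimod_iso_sum I (r : seq I) (F : I -> M) :
  f (\sum_(i <- r) F i) = \sum_(i <- r) f (F i).
Proof. by case: fiso => _ fD _ _; apply: (big_morph _ fD bimod_iso0). Qed.

(** Applied to an isomorphism and to its inverse, this equates the minimal numbers of generators. *)
Lemma bimod_iso_gen_left n : gen_left M n -> gen_left N n.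
Proof.
case=> g gP; exists (f \o g) => y; case: fiso => [[f' fK f'K] _ fZ _].
have [r rP] := gP (f' y); exists (phi \o r).
by rewrite -[y]f'K rP bimod_iso_sum; apply: eq_bigr => i _; apply: fZ.
Qed.

Lemma bimod_iso_gen_right n : gen_right M n -> gen_right N n.
Proof.
case=> g gP; exists (f \o g) => y; case: fiso => [[f' fK f'K] _ _ fR].
have [s sP] := gP (f' y); exists (psi \o s).
by rewrite -[y]f'K sP bimod_iso_sum; apply: eq_bigr => i _; apply: fR.
Qed.

Lemma bimod_iso_nontrivial : (exists m : M, m <> 0) -> exists n : N, n <> 0.
Proof.
case=> m m0; exists (f m) => fm0; apply: m0; case: fiso => [[f' fK _] _ _ _].
by rewrite -[m]fK fm0 -bimod_iso0 fK.
Qed.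
End BimoduleIso.

(** Bimodule isomorphisms and their inverses carry along nonzero elements and generating families,
    so edges and valuations agree. *)
Lemma premod_isoI (k : fieldType) (X Y : premodulation k)
    (theta : pm_vert X -> pm_vert Y)
    (phi : forall i, {lrmorphism pm_alg X i -> pm_alg Y (theta i)})
    (psi : forall i j, pm_bimod X i j -> pm_bimod Y (theta i) (theta j)) :
    bijective theta -> (forall i, bijective (phi i)) ->
    (forall i j, is_bimod_iso (phi i) (phi j) (psi i j)) ->
  premod_iso X Y.
Proof.
move=> thbij phibij psiP; exists theta; split; last first.
  by exists phi; split=> // i j; exists (psi i j).
have inv i j : exists (phi' : pm_alg Y (theta i) -> pm_alg X i)
    (psi' : pm_alg Y (theta j) -> pm_alg X j)
    (f : pm_bimod Y (theta i) (theta j) -> pm_bimod X i j),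
    is_bimod_iso phi' psi' f.
  case: (phibij i) (phibij j) => phi' _ phiK [psi' _ psiK].
  exists phi', psi'; exact: bimod_iso_inv (psiP i j) _ _ phiK psiK.
split=> // i j; have [phi' [psi' [f fP]]] := inv i j.
- split; [exact: bimod_iso_nontrivial (psiP i j) | exact: bimod_iso_nontrivial fP].
- congr (_, _); apply: eq_ex_minn => n; apply/asboolP/asboolP.
  + exact: bimod_iso_gen_right (psiP i j) n.
  + exact: bimod_iso_gen_right fP n.
  + exact: bimod_iso_gen_left (psiP i j) n.
  + exact: bimod_iso_gen_left fP n.
Qed.

(** * From algebra isomorphisms to pre-modulations *)

Section IsoParts.
Variables (k : fieldType) (Q P : quiver).
Variables (A : qvert Q -> falgType k) (B : qvert P -> falgType k).
Variable f : gpa A -> gpa B.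
Hypotheses (flin : linear f) (fmon : monoid_morphism f).
Local Notation phi := (@base_part _ _ (gpa_bimod A) (gpa_bimod B) f).

Lemma base_part_linear : linear phi.
Proof.
move=> c a b; rewrite /base_part tconstD.
have -> : tconst (gpa_bimod A) (c *: a) = (c *: (tconst _ a : gpa A) : gpa A).
  exact/esym/(@scalerA _ (talg (gpa_bimod A))).
by rewrite (flin c).
Qed.

Lemma base_part1 : phi 1 = 1.
Proof.
rewrite /base_part; have -> : tconst (gpa_bimod A) 1 = (1 : gpa A) by apply: scale1r.
by rewrite fmon.1.
Qed.

Lemma base_part_scalar c : phi (base_scalar A c) = base_scalar B c.
Proof.
rewrite -[base_scalar A c]mulr1 -base_scaleE (linear_scale _ _ base_part_linear).
by rewrite base_part1 base_scaleE mulr1.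
Qed.

(** By [base_hom_inj] it suffices that no e_i is killed. Its image under [f] is idempotent, so a
    zero degree 0 part would make that image zero, against injectivity. *)
Lemma base_part_inj : (forall i, simple_alg (A i)) -> injective f -> injective phi.
Proof.
move=> simA finj.
have fM : {morph f : x y / x * y} := fmon.2.
have f0 : f 0 = 0 by rewrite -[X in f X](subrr 0) (linear_sub flin) subrr.
apply: base_hom_inj => // [|a b|i]; first exact: base_part_linear.
  exact: (@base_partM _ _ (gpa_bimod A) (gpa_bimod B) f fM).
apply/eqP => p0; have e0 := bdelta_neq0 (oner_neq0 (A i)).
have p1 : f (tconst (gpa_bimod A) (bdelta (1 : A i))) = 0.
  apply: deg0_idem_eq0 p0; rewrite -[LHS]fM; congr f.
  by rewrite -[LHS]/(tconst _ _ * tconst _ _) -tconst_mul -bdeltaM mulr1.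
have c0 := finj _ _ (etrans p1 (esym f0)).
by move: e0; rewrite -(deg0_const (gpa_bimod A) (bdelta _)) c0 eqxx.
Qed.

Variable g : gpa B -> gpa A.
Hypotheses (fK : cancel f g) (gK : cancel g f).

Lemma inv_linear : linear g.
Proof. by move=> c x y; apply: (can_inj fK); rewrite flin !gK. Qed.
Lemma inv_monoid : monoid_morphism g.
Proof.
split=> [|x y]; apply: (can_inj fK); first by rewrite gK fmon.1.
by rewrite fmon.2 !gK.
Qed.
End IsoParts.

Section IsoBlocks.
Variables (k : fieldType) (Q P : quiver).
Variables (A : qvert Q -> falgType k) (B : qvert P -> falgType k).
Variables (f : gpa A -> gpa B) (g : gpa B -> gpa A).
Hypotheses (flin : linear f) (fmon : monoid_morphism f).
Hypotheses (glin : linear g) (gmon : monoid_morphism g).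
Hypotheses (fK : cancel f g) (gK : cancel g f).
Hypotheses (simA : forall i, simple_alg (A i)) (simB : forall j, simple_alg (B j)).

(** Injections in both directions suffice by dimension. The base part of [g] is not claimed to be
    the inverse, since [g] may send positive degree to elements with a degree 0 part. *)
Lemma base_part_bij : bijective (@base_part _ _ (gpa_bimod A) (gpa_bimod B) f).
Proof.
have [I [h hP]] := base_spanning B.
apply: (inj_inj_bij hP (base_part_linear flin) (base_part_linear glin)).
  exact: (base_part_inj flin fmon simA (can_inj fK)).
exact: (base_part_inj glin gmon simB (can_inj gK)).
Qed.

Lemma vec_part_linear (r : gpa_base B -> gpa_base A) :
    cancel r (@base_part _ _ (gpa_bimod A) (gpa_bimod B) f) ->
    cancel (@base_part _ _ (gpa_bimod A) (gpa_bimod B) f) r ->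
  linear (@vec_part _ _ (gpa_bimod A) (gpa_bimod B) f r
            : arrow_space A -> arrow_space B).
Proof.
move=> rK Kr c x y.
have fB : {morph f : x y / x - y} := linear_sub flin.
have fM : {morph f : x y / x * y} := fmon.2.
have := morphB_D (@vec_partB _ _ (gpa_bimod A) (gpa_bimod B) f fB r rK Kr).
move=> /(_ (c *: x) y) => ->; congr (_ + _).
apply: etrans (vec_partZ fM rK Kr (base_scalar A c) (x : gpa_bimod A)) _.
by rewrite base_part_scalar.
Qed.
End IsoBlocks.

Section PartsToPremodulation.
Variables (k : fieldType) (Q P : quiver).
Variables (A : qvert Q -> falgType k) (B : qvert P -> falgType k).

(** The permutation of the idempotents e_i under [phi] is the vertex bijection; cutting [phi] and
    [psi] with them gives the isomorphisms of the blocks. *)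
Lemma premod_iso_of_parts (phi : gpa_base A -> gpa_base B)
    (psi : gpa_bimod A -> gpa_bimod B) :
    (forall i, simple_alg (A i)) -> (forall j, simple_alg (B j)) ->
    linear phi -> {morph phi : a b / a * b} -> bijective phi ->
    {morph psi : m n / m - n} -> (forall a m, psi (a *: m) = phi a *: psi m) ->
    (forall m a, psi (ract m a) = ract (psi m) (phi a)) -> bijective psi ->
  premod_iso (gpa_premod A) (gpa_premod B).
Proof.
move=> simA simB philin phiM [phi' phiK phi'K] psiB psiZ psiR [psi' psiK psi'K].
have phiB := linear_sub philin.
have phi'B : {morph phi' : a b / a - b}.
  by move=> a b; apply: (can_inj phiK); rewrite phiB !phi'K.
have phi'M : {morph phi' : a b / a * b}.
  by move=> a b; apply: (can_inj phiK); rewrite phiM !phi'K.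
have [th thP] := boolp.choice (base_iso_unit phiB phiM phiK phi'K simA simB).
have [th' th'P] := boolp.choice (base_iso_unit phi'B phi'M phi'K phiK simB simA).
have thK : cancel th th'.
  by move=> i; apply: (@bdelta1_inj _ _ A); rewrite -th'P -thP phiK.
have th'K : cancel th' th.
  by move=> j; apply: (@bdelta1_inj _ _ B); rewrite -thP -th'P phi'K.
have blk i (x : A i) : phi (bdelta x) = bdelta (phi (bdelta x) (th i)).
  by rewrite -{1}[x]bdelta_in -mul_bdelta1 phiM thP mul_bdelta1.
have hlin i : linear (fun x : A i => phi (bdelta x) (th i)).
  move=> c x y /=; have := morphB_D (@bdeltaB _ _ A i) (c *: x) y => /= ->.
  by rewrite bdeltaZ philin baseD baseZ.
have hmon i : monoid_morphism (fun x : A i => phi (bdelta x) (th i)).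
  split=> [|x y]; first by rewrite thP bdelta_in.
  by rewrite bdeltaM phiM baseM.
pose h i : {lrmorphism A i -> B (th i)} :=
  HB.pack (fun x : A i => phi (bdelta x) (th i))
    (GRing.isLinear.Build k _ _ _ _ (hlin i))
    (GRing.isMonoidMorphism.Build _ _ _ (hmon i)).
pose f i j (m : arrow_bimod A i j) : arrow_bimod B (th i) (th j) :=
  psi (@adelta _ _ A (i, j) m) (th i, th j).
(* An element of block (i, j) is fixed by e_i on the left and e_j on the right, so semilinearity
   puts its image in block (th i, th j). *)
have blkM i j (m : arrow_bimod A i j) :
    psi (@adelta _ _ A (i, j) m) = @adelta _ _ B (th i, th j) (f i j m).
  have e := adelta_in (m : arrow_bimod A (i, j).1 (i, j).2).
  by rewrite -{1}e -block_adelta psiZ psiR !thP (@block_adelta _ _ _ (th i, th j)).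
apply: (@premod_isoI _ (gpa_premod A) (gpa_premod B) th h f) => [|i|i j].
- by exists th'.
- exists (fun y => phi' (bdelta y) i) => [x|y] /=.
    by rewrite -blk phiK bdelta_in.
  by rewrite -mul_bdelta1 phiM thP phi'K mul_bdelta1 !bdelta_in.
split.
- exists (fun n => psi' (@adelta _ _ B (th i, th j) n) (i, j)) => [m|n].
    by rewrite -blkM psiK (@adelta_in _ _ A (i, j)).
  (* The component of [psi'] at (i, j) is rewritten as a cut by e_i and e_j, which [psi] turns into
     the cut at the images. *)
  rewrite /f -(@block_adelta _ _ A (i, j)) psiZ psiR !thP psi'K.
  by rewrite (@block_adelta _ _ B (th i, th j)) !(@adelta_in _ _ B (th i, th j)).
- move=> m n; rewrite /f.
  have := morphB_D (@adeltaB _ _ A (i, j)) m n => ->.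
  by rewrite (morphB_D psiB) asumD.
- move=> a m; rewrite /f (@adeltaZ _ _ A (i, j)) psiZ.
  exact: (@asumZ _ _ B (phi (bdelta a)) _ (th i, th j)).
- move=> m a; rewrite /f (@adelta_ract _ _ A (i, j)) psiR.
  exact: (@asum_ractE _ _ B _ (phi (bdelta a)) (th i, th j)).
Qed.
End PartsToPremodulation.

Lemma premod_iso_of_gpa_iso (k : fieldType) (Q P : quiver)
    (A : qvert Q -> falgType k) (B : qvert P -> falgType k) :
    (forall i, simple_alg (A i)) -> (forall j, simple_alg (B j)) ->
    gpa_iso A B -> premod_iso (gpa_premod A) (gpa_premod B).
Proof.
move=> simA simB [f [flin fmon [g fK gK]]].
have glin := inv_linear flin fK gK; have gmon := inv_monoid fmon fK gK.
have fB : {morph f : x y / x - y} := linear_sub flin.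
have fM : {morph f : x y / x * y} := fmon.2.
have gB : {morph g : x y / x - y} := linear_sub glin.
have gM : {morph g : x y / x * y} := gmon.2.
have [r Kr rK] := base_part_bij flin fmon glin gmon fK gK simA simB.
have [s Ks sK] := base_part_bij glin gmon flin fmon gK fK simB simA.
have fsurj y : exists x, y = f x by exists (g y).
have gsurj x : exists y, x = g y by exists (f x).
have [I [h hP]] := arrow_spanning A.
apply: (@premod_iso_of_parts _ _ _ _ _
  (@base_part _ _ (gpa_bimod A) (gpa_bimod B) f)
  (@vec_part _ _ (gpa_bimod A) (gpa_bimod B) f r)) => //.
- exact: base_part_linear.
- exact: base_partM fM.
- by exists r.
- exact: vec_partB fB _ rK Kr.
- exact: vec_partZ fM _ rK Kr.
- exact: vec_part_ract fM _ rK Kr.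
(* The vector part of [g], formed with its own inverse [s], supplies the surjection in the other
   direction. *)
- apply: (surj_surj_bij hP (vec_part_linear flin fmon rK Kr)
    (vec_part_linear glin gmon sK Ks)).
    exact: vec_part_surj fB fM _ rK Kr fsurj.
  exact: vec_part_surj gB gM _ sK Ks gsurj.
Qed.

(** * From pre-modulations to algebra isomorphisms *)

(** Each [j] is [th] of its preimage, so the family is transported along that equality. *)
Lemma dep_reindex (I J : eqType) (th : I -> J) (T : J -> Type)
    (x : forall i, T (th i)) :
  bijective th -> exists y : forall j, T j, forall i, y (th i) = x i.
Proof.
case=> th' thK th'K.
exists (fun j => ecast j (T j) (th'K j) (x (th' j))) => i.
(* At [th i] the transport runs along a proof of [th i = th i], which is trivial over an
   [eqType]. *)
by move: (th'K (th i)); rewrite thK => e; rewrite eq_axiomK.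
Qed.

(** The existential form lets [cid] select an inverse for each vertex or block. *)
Lemma bij_inverse (T U : Type) (f : T -> U) :
  bijective f -> exists g, cancel f g /\ cancel g f.
Proof. by case=> g fK gK; exists g. Qed.

Section PremodulationToIso.
Variables (k : fieldType) (Q P : quiver).
Variables (A : qvert Q -> falgType k) (B : qvert P -> falgType k).

(** The block maps assemble into a ring isomorphism of the bases and a semilinear bijection of the
    bimodules, to which [talg_map] applies. *)
Lemma gpa_iso_of_parts (th : qvert Q -> qvert P)
    (h : forall i, {lrmorphism A i -> B (th i)})
    (psi : forall i j, arrow_bimod A i j -> arrow_bimod B (th i) (th j)) :
    bijective th -> (forall i, bijective (h i)) ->
    (forall i j, is_bimod_iso (h i) (h j) (psi i j)) ->
  gpa_iso A B.
Proof.
move=> thbij hbij psiP.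
pose th2 (p : qvert Q * qvert Q) := (th p.1, th p.2).
have th2bij : bijective th2.
  case: thbij => th' thK th'K; exists (fun p => (th' p.1, th' p.2)) => -[i j].
    by rewrite /th2 /= !thK.
  by rewrite /th2 /= !th'K.
(* As [th] is onto, equalities are tested at indices in its image, where the assembled maps are
   described without transport. *)
have bext (a b : gpa_base B) : (forall i, a (th i) = b (th i)) -> a = b.
  by case: thbij => th' _ th'K ab; apply/ffunP => j; rewrite -[j]th'K.
have aext (m n : gpa_bimod B) : (forall p, m (th2 p) = n (th2 p)) -> m = n.
  by case: th2bij => th' _ th'K ab; apply/ffunP => j; rewrite -[j]th'K.
have phiE (a : gpa_base A) : exists b : gpa_base B, forall i, b (th i) = h i (a i).
  have [b bE] := @dep_reindex _ _ th B (fun i => h i (a i)) thbij.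
  by exists (finfun b) => i; rewrite ffunE.
have psi0E (m : gpa_bimod A) : exists n : gpa_bimod B,
    forall p, n (th2 p) = psi p.1 p.2 (m p).
  have [n nE] := @dep_reindex _ _ th2 (fun p => arrow_bimod B p.1 p.2)
    (fun p => psi p.1 p.2 (m p)) th2bij.
  by exists (finfun n) => i; rewrite ffunE.
have [Phi PhiE] := boolp.choice phiE.
have [Psi PsiE] := boolp.choice psi0E.
have PhiB : {morph Phi : a b / a - b}.
  by move=> a b; apply: bext => i; rewrite baseB !PhiE baseB raddfB.
have PhiM : {morph Phi : a b / a * b}.
  by move=> a b; apply: bext => i; rewrite baseM !PhiE baseM rmorphM.
have Phi1 : Phi 1 = 1 by apply: bext => i; rewrite PhiE !base1 rmorph1.
have Phisc c : Phi (base_scalar A c) = base_scalar B c.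
  by apply: bext => i; rewrite PhiE !base_scalarE linearZ /= rmorph1.
have PsiB : {morph Psi : m n / m - n}.
  move=> m n; apply: aext => p; rewrite asumB !PsiE asumB.
  exact: bimod_isoB (psiP _ _) _ _.
have PsiZ a m : Psi (a *: m) = Phi a *: Psi m.
  apply: aext => p; rewrite asumZ !PsiE asumZ PhiE.
  by case: (psiP p.1 p.2).
have PsiR m a : Psi (ract m a) = ract (Psi m) (Phi a).
  apply: aext => p; rewrite asum_ractE !PsiE asum_ractE PhiE.
  by case: (psiP p.1 p.2).
have Phibij : bijective Phi.
  have hE i := cid (bij_inverse (hbij i)).
  exists (fun b : gpa_base B =>
      finfun (fun i => sval (hE i) (b (th i))) : gpa_base A) => a.
    by apply/ffunP => i; rewrite ffunE PhiE (svalP (hE i)).1.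
  by apply: bext => i; rewrite PhiE ffunE (svalP (hE i)).2.
have Psibij : bijective Psi.
  have psibij p : bijective (psi p.1 p.2) by case: (psiP p.1 p.2).
  have hE p := cid (bij_inverse (psibij p)).
  exists (fun n : arrow_sum B =>
      finfun (fun p => sval (hE p) (n (th2 p))) : arrow_sum A) => m.
    by apply/ffunP => p; rewrite ffunE PsiE (svalP (hE p)).1.
  by apply: aext => p; rewrite PsiE ffunE (svalP (hE p)).2.
exists (talg_map PhiB PhiM PsiB PsiZ PsiR); split.
(* Scalars of [k] act through [base_scalar], which [Phi] preserves. *)
- move=> c x y; apply: etrans (morphB_D (talg_mapB PhiB PhiM PsiB PsiZ PsiR) _ _) _.
  congr (_ + _); apply: etrans (talg_mapZ PhiB PhiM PsiB PsiZ PsiR _ _) _.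
  by rewrite Phisc.
- split; first exact: talg_map1.
  exact: talg_mapM.
- exact: talg_map_bij.
Qed.
End PremodulationToIso.

Theorem theorem5p5 (k : fieldType) (Q P : quiver)
    (A : qvert Q -> falgType k) (B : qvert P -> falgType k)
    (normA : normal_gpa A) (normB : normal_gpa B) :
  gpa_iso A B <-> premod_iso (gpa_premod A) (gpa_premod B).
Proof.
split; first exact: premod_iso_of_gpa_iso.
case=> th [[thbij _ _] [h [hbij psiE]]].
exact: (@gpa_iso_of_parts _ _ _ A B th h (fun i j => sval (cid (psiE i j))) thbij hbij
  (fun i j => svalP (cid (psiE i j)))).
Qed.
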